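(* Let $J=J_{a,b}$ be a $p$-periodic Jacobi matrix with integrated density of states $k$. There is a constant $C>0$ depending only on $\|a\|_\infty$ such that for every $E\in\mathbb{R}$ with $D(E)\in(-2,2)$, $$\frac{dk}{dE}(E)\ \ge\ \frac{C}{p}\sum_{j=1}^p\|M_j\|_2^2,$$ where $\|M\|_2=\sqrt{\mathrm{Tr}(M^*M)}$ is the Hilbert–Schmidt norm. If $a$ is a constant sequence $a_n\equiv a_0$, then equality holds with $C=\frac{1}{2(1+a_0^2)\pi}$.
   Context: $J_{a,b}$ acts on $\ell^2(\mathbb{Z})$ by $[Ju]_n=a_{n-1}u_{n-1}+b_nu_n+a_nu_{n+1}$ with $a_n>0$, $b_n\in\mathbb{R}$, $a_{n+p}=a_n$, $b_{n+p}=b_n$. The density of states measure $dk$ is defined by $\int f\,dk=\frac1p\sum_{n=0}^{p-1}\langle\delta_n,f(J)\delta_n\rangle$ and the integrated density of states is $k(E)=dk((-\infty,E])$. For energy $E$ let $T_j=\frac{1}{a_j}\begin{pmatrix}E-b_j & -1\\ a_j^2 & 0\end{pmatrix}$, $A_0=I$, $A_j=T_j\cdots T_1$ for $j\ge1$, and $\Phi_j=A_{j-1}A_pA_{j-1}^{-1}$; the discriminant is $D(E)=\mathrm{Tr}\,A_p$. When $D(E)\in(-2,2)$, each $\Phi_j\in\mathrm{SL}(2,\mathbb{R})$ has trace in $(-2,2)$ and $M_j\in\mathrm{SL}(2,\mathbb{R})$ denotes any matrix with $M_j\Phi_jM_j^{-1}\in\mathrm{SO}(2,\mathbb{R})$;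 such $M_j$ is unique up to left multiplication by an element of $\mathrm{SO}(2,\mathbb{R})$, so $\|M_j\|_2$ is well defined. *)

(* Defs.v *)
From HB Require Import structures.
From mathcomp Require Import all_boot all_order all_algebra.
From mathcomp Require Import all_classical all_reals all_analysis.
Set Implicit Arguments. Unset Strict Implicit. Unset Printing Implicit Defensive.
Import Order.TTheory GRing.Theory Num.Theory.
Import numFieldNormedType.Exports.
Local Open Scope classical_set_scope.
Local Open Scope ring_scope.

Section Jacobi.
Variable R : realType.

Definition jperiodic (a b : int -> R) (p : nat) : Prop :=
  forall n : int, a (n + p%:Z) = a n /\ b (n + p%:Z) = b n.

Definition Jop (a b : int -> R) (u : int -> R) : int -> R :=
  fun n => a (n - 1) * u (n - 1) + b n * u n + a n * u (n + 1).

Definition delta (n : int) : int -> R := fun m => if m == n then 1 else 0.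

Definition dos_moment (a b : int -> R) (p : nat) (m : nat) : R :=
  p%:R^-1 * \sum_(n < p) iter m (Jop a b) (delta (n : nat)%:Z) (n : nat)%:Z.

(* mu is the density of states measure dk: int f dk = (1/p) sum <delta_n, f(J) delta_n>.
   Since J is bounded, f(J) for continuous f is determined by polynomial f
   (Weierstrass), so dk is the unique compactly supported measure with these moments. *)
Definition is_dos (a b : int -> R) (p : nat) (mu : {measure set R -> \bar R}) : Prop :=
  (exists B : R, mu [set x : R | B < `|x|] = 0%E) /\
  forall m : nat, (\int[mu]_x ((x ^+ m)%:E) = (dos_moment a b p m)%:E)%E.

Definition ids (mu : {measure set R -> \bar R}) (E : R) : R := fine (mu [set x : R | x <= E]).

Definition mx2 (x y z w : R) : 'M[R]_2 :=
  \matrix_(i < 2, j < 2)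
    if (i == 0 :> nat) then (if (j == 0 :> nat) then x else y)
    else (if (j == 0 :> nat) then z else w).

Definition transfer (a b : int -> R) (E : R) (j : nat) : 'M[R]_2 :=
  (a j%:Z)^-1 *: mx2 (E - b j%:Z) (-1) (a j%:Z ^+ 2) 0.

Fixpoint Amat (a b : int -> R) (E : R) (j : nat) : 'M[R]_2 :=
  match j with
  | 0 => 1%:M
  | j'.+1 => transfer a b E j'.+1 *m Amat a b E j'
  end.

Definition discr (a b : int -> R) (p : nat) (E : R) : R := \tr (Amat a b E p).

Definition Phi (a b : int -> R) (p : nat) (E : R) (j : nat) : 'M[R]_2 :=
  Amat a b E j.-1 *m Amat a b E p *m invmx (Amat a b E j.-1).

Definition inSL2 (M : 'M[R]_2) : Prop := \det M = 1.
Definition inSO2 (M : 'M[R]_2) : Prop := M^T *m M = 1%:M /\ \det M = 1.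

Definition hs_norm (M : 'M[R]_2) : R := Num.sqrt (\tr (M^T *m M)).

Definition supnorm (a : int -> R) (p : nat) : R :=
  \big[Num.max/0]_(n < p) `|a (n : nat)%:Z|.

End Jacobi.

(* Main.v *)
Require Import Defs.
From HB Require Import structures.
From mathcomp Require Import all_boot all_order all_algebra.
From mathcomp Require Import all_classical all_reals all_analysis measurable_realfun.
From mathcomp Require Import zify ring lra.
Import Order.TTheory GRing.Theory Num.Theory.
Import numFieldNormedType.Exports.
Local Open Scope classical_set_scope.
Local Open Scope ring_scope.
Set Implicit Arguments.
Unset Strict Implicit.
Unset Printing Implicit Defensive.

(** The sequence [n |-> delta n] solves the three-term recurrence with the energy
    replaced by J itself, so Cayley-Hamilton for the monodromy matrix gives the magic
    formula D(J) = S^p + S^-p, S the shift.  Hence the Chebyshev polynomials of D(J)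
    have vanishing diagonal, even after multiplication by a q(J) of band width < p: under
    q dk, the function D has the arcsine law.  Apply this to q = 1 and to
    K(x) = (D(x) - D(E)) / (x - E).  Since K(J) delta_j is explicitly built from transfer
    matrices, the mean of K is -(1/p) sum_j (Phi_j)_12.  Where D(x) is close to D(E)
    but x is away from E, K is small; hence only the x near E contribute to the integral
    of K over a thin level set of D, and this yields dk/dE(E) directly, without
    any spectral theory.  Finally (Phi_j)_12 = -s |M_j e_2|^2 and (Phi_j)_21 = s |M_j e_1|^2
    with s^2 = 1 - D(E)^2/4, while (Phi_(j+1))_21 = - a_j^2 (Phi_j)_12, so that
    sum_j ||M_j||^2 = sum_j (1 + a_j^2) |M_j e_2|^2. *)

(** * Transfer matrices over a commutative ring *)

Section TransferMatrices.
Context {S : comNzRingType}.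
Variables al ai x : int -> S.

(** Acts on the pair [(u n, al (n - 1) * u (n - 1))], with [ai] inverse to [al] and [x n] the energy
    minus [b n]. Over a general ring the energy may be a number or the polynomial variable. *)
Definition tmx (n : int) : 'M[S]_2 :=
  \matrix_(i < 2, j < 2)
    if i == 0 then (if j == 0 then ai n * x n else - ai n)
    else (if j == 0 then al n else 0).

Fixpoint tprod (m : int) (k : nat) : 'M[S]_2 :=
  if k is k'.+1 then tmx (m + k'%:Z) *m tprod m k' else 1%:M.

Lemma tprodS m k : tprod m k.+1 = tmx (m + k%:Z) *m tprod m k.
Proof. by []. Qed.

Lemma mulmx2E (A B : 'M[S]_2) i j : (A *m B) i j = A i 0 * B 0 j + A i 1 * B 1 j.
Proof. by rewrite mxE big_ord_recr big_ord1; congr (A _ _ * B _ _ + A _ _ * B _ _); apply: val_inj. Qed.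

Lemma mxtrace2E (A : 'M[S]_2) : \tr A = A 0 0 + A 1 1.
Proof. by rewrite /mxtrace big_ord_recr big_ord1; congr (A _ _ + A _ _); apply: val_inj. Qed.

Lemma det_mx2E (A : 'M[S]_2) : \det A = A 0 0 * A 1 1 - A 0 1 * A 1 0.
Proof.
rewrite (expand_det_row _ 0) big_ord_recr big_ord1 /cofactor !det_mx11 !mxE.
have l1 : lift (0 : 'I_2) 0 = 1 by apply: val_inj.
have w0 : widen_ord (leqnSn 1) 0 = 0 :> 'I_2 by apply: val_inj.
have m1 : ord_max = 1 :> 'I_2 by apply: val_inj.
have l0 : lift (1 : 'I_2) 0 = 0 by apply: val_inj.
by rewrite w0 m1 l1 l0 /= expr0 mul1r expr1 mulN1r mulrN.
Qed.

Lemma forall_ord2 (P : 'I_2 -> Prop) : P 0 -> P 1 -> forall i, P i.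
Proof.
move=> P0 P1 [[|[|//]] lti]; first by rewrite (_ : Ordinal lti = 0) //; apply: val_inj.
by rewrite (_ : Ordinal lti = 1) //; apply: val_inj.
Qed.

Lemma tprodD m k l : tprod m (k + l) = tprod (m + k%:Z) l *m tprod m k.
Proof.
elim: l => [|l IH]; first by rewrite addn0 mul1mx.
by rewrite addnS !tprodS IH mulmxA PoszD addrA.
Qed.

Lemma cayley_hamilton2 (B : 'M[S]_2) : \det B = 1 -> B *m B = \tr B *: B - 1%:M.
Proof.
rewrite det_mx2E mxtrace2E => dB; apply/matrixP.
apply: forall_ord2; apply: forall_ord2; rewrite mulmx2E !mxE /= ?mulr1n ?mulr0n -?dB; ring.
Qed.

Hypothesis alK : forall n, al n * ai n = 1.

Lemma det_tmx n : \det (tmx n) = 1.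
Proof. by rewrite det_mx2E !mxE /= mulr0 sub0r mulNr opprK mulrC alK. Qed.

Lemma det_tprod m k : \det (tprod m k) = 1.
Proof. by elim: k => [|k IH]; rewrite ?det1// tprodS det_mulmx IH det_tmx mulr1. Qed.

Variable p : nat.
Hypothesis perm_al : forall n, al (n + p%:Z) = al n.
Hypothesis per_ai : forall n, ai (n + p%:Z) = ai n.
Hypothesis per_x : forall n, x (n + p%:Z) = x n.

Lemma tmx_per n : tmx (n + p%:Z) = tmx n.
Proof. by rewrite /tmx perm_al per_ai per_x. Qed.

Lemma tprod_per m k : tprod (m + p%:Z) k = tprod m k.
Proof. by elim: k => // k IH; rewrite !tprodS IH addrAC tmx_per. Qed.

Lemma tprod_monodromyC m k :
  tprod (m + k%:Z) p *m tprod m k = tprod m k *m tprod m p.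
Proof. by rewrite -tprodD addnC tprodD tprod_per. Qed.

(** Conjugation by [tmx n] carries the monodromy at [n] to the one at [n + 1]. As [tmx n] has
    determinant 1, its adjugate serves as its inverse over any ring. *)
Lemma tr_tprod_shift m k : \tr (tprod (m + k%:Z) p) = \tr (tprod m p).
Proof.
elim: k => [|k IH]; first by rewrite addr0.
rewrite -IH (_ : m + k.+1%:Z = m + k%:Z + 1); last by lia.
set n := m + k%:Z.
have := tprod_monodromyC n 1; rewrite /= addr0 mulmx1 => E.
have -> : tprod (n + 1) p = tmx n *m tprod n p *m \adj (tmx n).
  by rewrite -E -mulmxA mul_mx_adj det_tmx mulmx1.
by rewrite mxtrace_mulC mulmxA mul_adj_mx det_tmx mul1mx.
Qed.

Lemma tr_tprod m m' : \tr (tprod m p) = \tr (tprod m' p).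
Proof.
wlog le_mm : m m' / m <= m'.
  by move=> H; case/orP: (le_total m m') => h; [|symmetry]; apply: H.
have -> : m' = m + `|m' - m|%N%:Z by lia.
by rewrite tr_tprod_shift.
Qed.

(** Cayley-Hamilton for the monodromy at site [m + k], which has determinant 1. *)
Lemma tprod_recurrence m k :
  tprod m (k + p.*2) = \tr (tprod 0 p) *: tprod m (k + p) - tprod m k.
Proof.
rewrite -addnn !tprodD tprod_per cayley_hamilton2 ?det_tprod//.
by rewrite mulmxBl mul1mx -scalemxAl (tr_tprod _ 0).
Qed.

(* The solution of (J - x) u = delta_m that vanishes to the left of m. *)
Definition retarded (m n : int) : S :=
  if m <= n then - tprod m `|n - m|%N 0 1 else 0.

Lemma retarded_lt m n : n <= m -> retarded m n = 0.
Proof.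
rewrite /retarded; case: ifP => // h1 h2.
have -> : n = m by lia.
by rewrite subrr /= mxE oppr0.
Qed.

Lemma retardedE m k : retarded m (m + k%:Z) = - tprod m k 0 1.
Proof. by rewrite /retarded lerDl /= addrAC subrr add0r. Qed.

Lemma retarded_eq m n :
  al n * retarded m (n + 1) = x n * retarded m n - al (n - 1) * retarded m (n - 1) + (n == m)%:R.
Proof.
have [lt_nm|] := ltP n m.
  rewrite !retarded_lt ?(lt_eqF lt_nm) /= ?mulr0n; try lia; ring.
rewrite le_eqVlt => /predU1P[<-|lt_mn].
  rewrite (@retarded_lt m m)// (@retarded_lt m (m - 1)); last by lia.
  by rewrite (retardedE m 1%N) /= mulmx2E addr0 !mxE /= mulr0 mulr1 add0r opprK alK eqxx /= mulr1n; ring.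
rewrite gt_eqF// /= mulr0n addr0.
have [k -> ] : exists k : nat, n = m + k.+1%:Z by exists (absz (n - m - 1)%R); lia.
have -> : m + k.+1%:Z + 1 = m + k.+2%:Z by lia.
have -> : m + k.+1%:Z - 1 = m + k%:Z by lia.
have e n0 l : tprod n0 l.+1 0 1 = ai (n0 + l%:Z) * x (n0 + l%:Z) * tprod n0 l 0 1 - ai (n0 + l%:Z) * tprod n0 l 1 1.
  by rewrite tprodS mulmx2E [tmx _ 0 0]mxE [tmx _ 0 1]mxE /= mulNr.
have e1 : tprod m k.+1 1 1 = al (m + k%:Z) * tprod m k 0 1.
  by rewrite tprodS mulmx2E [tmx _ 1 0]mxE [tmx _ 1 1]mxE /= mul0r addr0.
rewrite !retardedE e e1 opprB mulrBr !mulrA alK !mul1r; ring.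
Qed.

(** Its sources are those of [(D(J) - D(x)) delta_j] according to the magic formula, so this is the
    explicit candidate for [K(J) delta_j]. *)
Definition wave (j n : int) : S :=
  retarded (j - p%:Z) n + retarded (j + p%:Z) n - \tr (tprod 0 p) * retarded j n.

Lemma wave_eq j n :
  al n * wave j (n + 1) = x n * wave j n - al (n - 1) * wave j (n - 1)
   + ((n == j - p%:Z)%:R + (n == j + p%:Z)%:R - \tr (tprod 0 p) * (n == j)%:R).
Proof.
rewrite /wave mulrBr mulrDr !retarded_eq.
rewrite [al n * (_ * _)]mulrCA retarded_eq; ring.
Qed.

Lemma wave_lt j n : n <= j - p%:Z -> wave j n = 0.
Proof. by move=> h; rewrite /wave !retarded_lt ?mulr0 ?subr0 ?addr0//; lia. Qed.

(** From the last source on, the three terms are values of one solution a period apart, and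
    [tprod_recurrence] makes the combination cancel. *)
Lemma wave_gt j n : j + p%:Z <= n -> wave j n = 0.
Proof.
move=> h; have [k ->] : exists k : nat, n = j + p%:Z + k%:Z by exists (absz (n - j - p%:Z)%R); lia.
rewrite /wave retardedE.
have -> : j + p%:Z + k%:Z = j + (k + p)%:Z by lia.
have {1}-> : j + (k + p)%N = j - p%:Z + (k + p.*2)%:Z by rewrite -addnn; lia.
rewrite !retardedE tprod_per.
have -> q : tprod (j - p%:Z) q = tprod j q by rewrite -{2}(subrK p%:Z j) tprod_per.
rewrite tprod_recurrence !mxE; ring.
Qed.

(** At site [j] only the solution started one period to the left has left zero. *)
Lemma wave_diag j : (0 < p)%N -> wave j j = - tprod j p 0 1.
Proof.
move=> p0; rewrite /wave (@retarded_lt (j + p%:Z)); last by lia.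
rewrite (@retarded_lt j)// mulr0 subr0 addr0.
rewrite -{2}(subrK p%:Z j) retardedE.
by rewrite -(tprod_per (j - _)) subrK.
Qed.

End TransferMatrices.

(** * Polynomials of the Jacobi operator *)

Section PolynomialCalculus.
Context {R : realType}.
Variables a b : int -> R.
Local Notation J := (Jop a b).
Local Notation delta := (@delta R).

(** This is [q(J) u]. As [J] couples only neighbours, it makes sense on arbitrary sequences, without
    any summability. *)
Definition pact (q : {poly R}) (u : int -> R) : int -> R :=
  fun k => \sum_(i < size q) q`_i * iter i J u k.

Lemma pact_widen N (q : {poly R}) u k : (size q <= N)%N ->
  pact q u k = \sum_(i < N) q`_i * iter i J u k.
Proof.
move=> h; rewrite /pact (big_ord_widen N (fun i => q`_i * iter i J u k))// big_mkcond.
by apply: eq_bigr => i _; case: ltnP => // h'; rewrite nth_default// mul0r.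
Qed.

Lemma JopDZ c u v : J (fun k => c * u k + v k) = (fun k => c * J u k + J v k).
Proof. by apply/funext => k; rewrite /Jop; ring. Qed.

Lemma pactDl q r u : pact (q + r) u = (fun k => pact q u k + pact r u k).
Proof.
apply/funext => k; pose N := maxn (size q) (size r).
rewrite !(@pact_widen N) ?leq_maxl ?leq_maxr ?size_polyD// -big_split /=.
by apply: eq_bigr => i _; rewrite coefD mulrDl.
Qed.

Lemma pactZl c q u : pact (c *: q) u = (fun k => c * pact q u k).
Proof.
apply/funext => k; rewrite (@pact_widen (size q)) ?size_scale_leq// mulr_sumr.
by apply: eq_bigr => i _; rewrite coefZ mulrA.
Qed.

Lemma pactDZ q c u v :
  pact q (fun k => c * u k + v k) = (fun k => c * pact q u k + pact q v k).
Proof.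
apply/funext => k; rewrite /pact mulr_sumr -big_split; apply: eq_bigr => i _ /=.
suff -> : iter i J (fun k => c * u k + v k) = (fun k => c * iter i J u k + iter i J v k) by ring.
by elim: (i : nat) => //= n ->; rewrite JopDZ.
Qed.

Lemma pactC c u : pact c%:P u = (fun k => c * u k).
Proof.
by apply/funext => k; rewrite (@pact_widen 1) ?size_polyC_leq1// big_ord1 coefC.
Qed.

Lemma pactMX q u : pact (q * 'X) u = pact q (J u).
Proof.
apply/funext => k; rewrite (@pact_widen (size q).+1).
  rewrite big_ord_recl coefMX mul0r add0r; apply: eq_bigr => i _.
  by rewrite coefMX /= -iterS iterSr.
by have [->|q0] := eqVneq q 0; rewrite ?mul0r ?size_poly0// size_mulX.
Qed.

Lemma pact0 u : pact 0 u = (fun=> 0).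
Proof. by apply/funext => k; rewrite /pact size_poly0 big_ord0. Qed.

Lemma pact_J q u : pact q (J u) = J (pact q u).
Proof.
elim/poly_ind: q u => [|q c IH] u.
  by rewrite !pact0; apply/funext => k; rewrite /Jop; ring.
rewrite !pactDl !pactMX !pactC !IH.
by apply/funext => k; rewrite /Jop; ring.
Qed.

Lemma pactM q r u : pact (q * r) u = pact q (pact r u).
Proof.
elim/poly_ind: q u => [|q c IH] u; first by rewrite mul0r !pact0.
rewrite mulrDl !pactDl mulrAC !pactMX IH mul_polyC pactZl pactC pact_J.
by [].
Qed.

Lemma pactB q r u : pact (q - r) u = (fun k => pact q u k - pact r u k).
Proof. by rewrite -scaleN1r pactDl pactZl; apply/funext => k; rewrite mulN1r. Qed.

Lemma pactDr q u v : pact q (fun k => u k + v k) = (fun k => pact q u k + pact q v k).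
Proof.
rewrite (_ : (fun k => u k + v k) = (fun k => 1 * u k + v k)).
  by rewrite pactDZ; apply/funext => k; ring.
by apply/funext => k; ring.
Qed.

Lemma pact_left_support q u N : (forall n, n <= N -> u n = 0) ->
  exists N', forall n, n <= N' -> pact q u n = 0.
Proof.
elim/poly_ind: q u N => [|q c IH] u N h; first by exists 0 => n; rewrite pact0.
have [N' hN'] : exists N', forall n, n <= N' -> pact q (J u) n = 0.
  by apply: (IH _ (N - 1)) => n hn; rewrite /Jop !h ?mulr0 ?addr0//; lia.
exists (Num.min N N') => n hn; rewrite pactDl pactMX pactC hN' ?h ?mulr0 ?addr0//; lia.
Qed.

(** Since [a n] is nonzero, the equation at [n] determines the value at [n + 1] from those at [n]
    and [n - 1]; starting from zeros on the left, the sequences agree site by site. *)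
Lemma Jop_shift_inj y u v N : (forall n, a n != 0) ->
  (forall n, n <= N -> u n = 0) -> (forall n, n <= N -> v n = 0) ->
  (forall n, J u n - y * u n = J v n - y * v n) -> u = v.
Proof.
move=> a0 hu hv E.
suff H (k : nat) : u (N + k%:Z) = v (N + k%:Z) /\ u (N + k%:Z - 1) = v (N + k%:Z - 1).
  apply/funext => n; have [h|h] := leP n N; first by rewrite hu ?hv.
  by have [e _] := H (absz (n - N)%R); rewrite (_ : n = N + absz (n - N)%R)//; lia.
elim: k => [|k [IH1 IH2]]; first by rewrite !hu ?hv//; lia.
have -> : N + k.+1%:Z = N + k%:Z + 1 by lia.
rewrite addrK; split => //; have := E (N + k%:Z); rewrite /Jop IH1 IH2.
by move=> /addIr /addrI /(mulfI (a0 _)).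
Qed.

Lemma delta_diag n : delta n n = 1.
Proof. by rewrite /Defs.delta eqxx. Qed.

Lemma Jop_delta n :
  J (delta n) = fun k => a n * delta (n + 1) k + b n * delta n k + a (n - 1) * delta (n - 1) k.
Proof.
apply/funext => k; rewrite /Jop /Defs.delta subr_eq.
have -> : (k + 1 == n) = (k == n - 1) by rewrite eq_sym -subr_eq eq_sym.
congr (_ + _ + _); case: eqVneq => [e|_]; rewrite ?mulr0//; congr (_ * _); congr (_ _); lia.
Qed.

Lemma delta_succ n : a n != 0 ->
  delta (n + 1) = fun k => (a n)^-1 * (J (delta n) k - b n * delta n k - a (n - 1) * delta (n - 1) k).
Proof. by move=> h; apply/funext => k; rewrite Jop_delta; field. Qed.

End PolynomialCalculus.

(** * The magic formula *)

Section MagicFormula.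
Context {R : realType}.
Variables (a b : int -> R) (p : nat).
Hypothesis a_gt0 : forall n, 0 < a n.
Hypothesis per : jperiodic a b p.
Hypothesis p_gt0 : (0 < p)%N.
Local Notation J := (Jop a b).
Local Notation delta := (@delta R).
Local Notation pact := (pact a b).

Let a_neq0 n : a n != 0. Proof. by rewrite gt_eqF. Qed.
Let per_a n : a (n + p%:Z) = a n. Proof. exact: (per n).1. Qed.
Let per_b n : b (n + p%:Z) = b n. Proof. exact: (per n).2. Qed.

Definition tprodX : int -> nat -> 'M[{poly R}]_2 :=
  tprod (fun n => (a n)%:P) (fun n => (a n)^-1%:P) (fun n => 'X - (b n)%:P).
Definition tprodE (y : R) : int -> nat -> 'M[R]_2 :=
  tprod a (fun n => (a n)^-1) (fun n => y - b n).

Definition discrX : {poly R} := \tr (tprodX 0 p).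

Lemma horner_tprodX y m k i j : (tprodX m k i j).[y] = tprodE y m k i j.
Proof.
elim: k i j => [|k IH] i j; first by rewrite /= !mxE hornerMn hornerC.
rewrite /tprodX /tprodE !tprodS !mulmx2E hornerD !hornerM !IH !mxE.
by congr (_ * _ + _ * _); do ?[case: ifP => _]; rewrite !hornerE.
Qed.

Lemma horner_discrX y : discrX.[y] = \tr (tprodE y 0 p).
Proof. by rewrite /discrX !mxtrace2E hornerD !horner_tprodX. Qed.

Let aXK n : (a n)%:P * ((a n)^-1)%:P = 1 :> {poly R}.
Proof. by rewrite -polyCM mulfV. Qed.

Let aEK n : a n * (a n)^-1 = 1. Proof. by rewrite mulfV. Qed.

Let perX_a n : (a (n + p%:Z))%:P = (a n)%:P. Proof. by rewrite per_a. Qed.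
Let perX_i n : ((a (n + p%:Z))^-1)%:P = ((a n)^-1)%:P. Proof. by rewrite per_a. Qed.
Let perX_x n : 'X - (b (n + p%:Z))%:P = 'X - (b n)%:P. Proof. by rewrite per_b. Qed.
Let perE_i n : (a (n + p%:Z))^-1 = (a n)^-1. Proof. by rewrite per_a. Qed.
Let perE_x y n : y - b (n + p%:Z) = y - b n. Proof. by rewrite per_b. Qed.

Lemma tprodX_recurrence m k :
  tprodX m (k + p.*2) = discrX *: tprodX m (k + p) - tprodX m k.
Proof. exact: tprod_recurrence. Qed.

(** The polynomial is an entry in the first row of a product with [tmx], so this expresses one
    transfer step through the action of [J]. *)
Lemma pact_row0 c d q r u :
  pact (c%:P * ('X - d%:P) * q + - c%:P * r) u
    = fun n => c * (J (pact q u) n - d * pact q u n - pact r u n).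
Proof.
have -> : c%:P * ('X - d%:P) * q + - c%:P * r = c *: (q * 'X - d *: q - r).
  by rewrite -!mul_polyC; ring.
by rewrite pactZl !pactB pactMX pact_J pactZl.
Qed.

Lemma pact_row1 c q r u : pact (c%:P * q + 0 * r) u = fun n => c * pact q u n.
Proof. by rewrite mul0r addr0 mul_polyC pactZl. Qed.

(* [n |-> delta n] satisfies the three-term recurrence with the energy replaced by [J]. *)
Lemma delta_tprodX m k :
  (delta (m + k%:Z) = fun n =>
     a (m - 1) * pact (tprodX m k 0 1) (delta (m - 1)) n + pact (tprodX m k 0 0) (delta m) n)
  /\ ((fun n => a (m + k%:Z - 1) * delta (m + k%:Z - 1) n) = fun n =>
     a (m - 1) * pact (tprodX m k 1 1) (delta (m - 1)) n + pact (tprodX m k 1 0) (delta m) n).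
Proof.
elim: k => [|k [IH0 IH1]].
  rewrite /= addr0 !mxE /= mulr1n mulr0n -polyC1 -polyC0 !pactC.
  by split; apply/funext => n; ring.
have -> : m + k.+1%:Z = m + k%:Z + 1 by lia.
rewrite addrK [tprodX m k.+1]tprodS !mulmx2E ![tmx _ _ _ _ _ _]mxE /= -/tprodX.
rewrite !pact_row0 !pact_row1; split; apply/funext => n.
  rewrite (@delta_succ _ a b)//; have /= -> := congr1 (@^~ n) IH1; rewrite IH0 JopDZ.
  have E (c d e x1 x2 x3 x4 x5 x6 : R) : c * (e * x1 + x2 - d * (e * x3 + x4) - (e * x5 + x6))
    = e * (c * (x1 - d * x3 - x5)) + c * (x2 - d * x4 - x6) by ring.
  by rewrite E.
by rewrite IH0; ring.
Qed.

(** The magic formula. With [m = j - p], [tprodX_recurrence] over two periods, evaluated at [J],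
    reads [delta (m + 2p) = D(J) delta (m + p) - delta m]. *)
Lemma pact_discr j :
  pact discrX (delta j) = fun n => delta (j + p%:Z) n + delta (j - p%:Z) n.
Proof.
have [m ->] : exists m, j = m + p%:Z by exists (j - p%:Z); rewrite subrK.
have [d0 _] := delta_tprodX m 0; have [d1 _] := delta_tprodX m p.
have [d2 _] := delta_tprodX m (0 + p.*2).
have -> : m + p%:Z + p%:Z = m + (0 + p.*2)%:Z by rewrite add0n -addnn; lia.
rewrite d2 tprodX_recurrence add0n d1 pactDZ addrK.
apply/funext => n; have /= := congr1 (@^~ n) d0; rewrite addr0 => ->.
have mE i1 i2 : (discrX *: tprodX m p - tprodX m 0) i1 i2 = discrX * tprodX m p i1 i2 - tprodX m 0 i1 i2.
  by rewrite !mxE.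
rewrite !mE !pactB !pactM.
have E (c x y u v : R) : c * x + y = c * (x - u) + (y - v) + (c * u + v) by ring.
exact: E.
Qed.

(** These are [2 T_n(D/2)] with [T_n] the Chebyshev polynomial, hence the value 2 at [n = 0]. This
    normalization turns [S^p + S^-p] into [S^(np) + S^-(np)]. *)
Fixpoint chebX (n : nat) : {poly R} :=
  match n with
  | 0 => 2%:P
  | n1.+1 => if n1 is n2.+1 then discrX * chebX n1 - chebX n2 else discrX
  end.

Lemma pact_cheb j n :
  pact (chebX n) (delta j) = fun k => delta (j + (n * p)%:Z) k + delta (j - (n * p)%:Z) k.
Proof.
elim/ltn_ind: n j => -[|[|n]] IH j.
- by rewrite /= pactC mul0n ?addr0 ?subr0; apply/funext => k; ring.
- by rewrite /= mul1n pact_discr.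
rewrite (_ : chebX n.+2 = discrX * chebX n.+1 - chebX n)// pactB pactM !IH//.
rewrite pactDr !pact_discr.
have -> : j + (n.+2 * p)%:Z = j + (n.+1 * p)%:Z + p%:Z by rewrite !mulSn; lia.
have -> : j - (n.+2 * p)%:Z = j - (n.+1 * p)%:Z - p%:Z by rewrite !mulSn; lia.
have -> : j + (n * p)%:Z = j + (n.+1 * p)%:Z - p%:Z by rewrite !mulSn; lia.
have -> : j - (n * p)%:Z = j - (n.+1 * p)%:Z + p%:Z by rewrite !mulSn; lia.
by apply/funext => k; ring.
Qed.

Definition diffquot (y : R) : {poly R} := (discrX - discrX.[y]%:P) %/ ('X - y%:P).

Lemma diffquotE y : diffquot y * ('X - y%:P) = discrX - discrX.[y]%:P.
Proof.
apply: divpK; rewrite dvdp_XsubCl /root !hornerE; apply/eqP; ring.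
Qed.

Definition waveE y := wave a (fun n => (a n)^-1) (fun n => y - b n) p.

(** Both sides vanish far to the left and solve [(J - y) u = (D(J) - D(y)) delta_j], so
    [Jop_shift_inj] identifies them. *)
Lemma pact_diffquot y j : pact (diffquot y) (delta j) = waveE y j.
Proof.
have [N hN] : exists N', forall n, n <= N' -> pact (diffquot y) (delta j) n = 0.
  by apply: (@pact_left_support _ _ _ _ _ (j - 1)) => n h; rewrite /delta; case: eqVneq => //; lia.
apply: (@Jop_shift_inj _ a b y _ _ (Num.min N (j - p%:Z))) => //.
- by move=> n h; apply: hN; lia.
- by move=> n h; apply: wave_lt; lia.
move=> n.
have -> : J (pact (diffquot y) (delta j)) n - y * pact (diffquot y) (delta j) n
    = pact (discrX - discrX.[y]%:P) (delta j) n.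
  by rewrite -diffquotE mulrBr pactB pactMX pact_J [_ * y%:P]mulrC mul_polyC pactZl.
rewrite pactB pactC pact_discr horner_discrX /Jop.
have := @wave_eq _ a (fun n => (a n)^-1) (fun n => y - b n) aEK p j n.
rewrite -/(waveE y) => ->; rewrite /delta.
do 3![case: eqP => _]; rewrite /= ?mulr1n ?mulr0n /tprodE; ring.
Qed.

Definition banded (q : {poly R}) : Prop :=
  forall j n, p%:Z <= `|n - j| -> pact q (delta j) n = 0.

Lemma banded_diffquot y : banded (diffquot y).
Proof.
move=> j n h; rewrite pact_diffquot.
have [h'|h'] := leP n (j - p%:Z); first by rewrite /waveE wave_lt.
by rewrite /waveE wave_gt//; lia.
Qed.

Lemma bandedC c : banded c%:P.
Proof.
move=> j n h; rewrite pactC /delta; case: eqVneq => [e|_]; rewrite ?mulr0//.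
by move: h; rewrite e subrr normr0; lia.
Qed.

(** [chebX n] moves [delta j] by [n * p >= p] sites to either side, out of the reach of a banded
    [q]. *)
Lemma banded_cheb q n j : banded q -> (0 < n)%N -> pact (q * chebX n) (delta j) j = 0.
Proof.
move=> bq n0; rewrite pactM pact_cheb pactDr !bq ?addr0//.
  by rewrite opprB addrCA subrr addr0 ger0_norm// lez_nat leq_pmull.
by rewrite opprD addrA subrr sub0r normrN ger0_norm// lez_nat leq_pmull.
Qed.

Lemma diffquot_diag y j : pact (diffquot y) (delta j) j = - tprodE y j p 0 1.
Proof. by rewrite pact_diffquot /waveE wave_diag. Qed.

End MagicFormula.

(** * Arcsine means and step polynomials *)

Section ArcsineMean.
Context {R : realType}.
Implicit Types (f : {poly R}) (c t x y eps : R).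

(** Again [2 T_n(x/2)], so that composition with [discrX] gives [chebX]. *)
Fixpoint cheb (n : nat) : {poly R} :=
  match n with
  | 0 => 2%:P
  | n1.+1 => if n1 is n2.+1 then 'X * cheb n1 - cheb n2 else 'X
  end.

Lemma chebSS n : cheb n.+2 = 'X * cheb n.+1 - cheb n. Proof. by []. Qed.

Lemma horner_cheb n t : (cheb n).[2 * cos t] = 2 * cos (n%:R * t).
Proof.
elim/ltn_ind: n => -[|[|n]] IH.
- by rewrite /= mul0r cos0 hornerC mulr1.
- by rewrite /= mul1r hornerX.
rewrite chebSS !hornerE !IH//.
have -> : n.+2%:R * t = n.+1%:R * t + t by rewrite -(natr1 n.+1); ring.
have -> : n%:R * t = n.+1%:R * t - t by rewrite -(natr1 n); ring.
rewrite cosB cosD; ring.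
Qed.

(* [c] is the mean of [f (2 cos t)] over [0, pi], certified by a primitive of the difference. *)
Definition arc_mean f c : Prop :=
  exists S : R -> R, [/\ S 0 = 0, S pi = 0 &
    forall t : R, is_derive t 1 S (f.[2 * cos t] - c)].

Lemma sin_natpi n : sin (n%:R * pi) = 0 :> R.
Proof.
elim: n => [|n IH]; first by rewrite mul0r sin0.
by rewrite -natr1 mulrDl mul1r sinD IH sinpi mulr0 mul0r addr0.
Qed.

Lemma arc_mean_cheb n : (0 < n)%N -> arc_mean (cheb n) 0.
Proof.
move=> n0; exists (fun t => 2 / n%:R * sin (n%:R * t)); split => [||t].
- by rewrite mulr0 sin0 mulr0.
- by rewrite sin_natpi mulr0.
rewrite horner_cheb; apply: is_derive_eq.
rewrite /GRing.scale /=; field.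
by rewrite pnatr_eq0 -lt0n.
Qed.

Lemma arc_mean1 : arc_mean 1 1.
Proof.
exists (cst 0); split => // t; rewrite hornerE subrr; exact: is_derive_cst.
Qed.

Lemma arc_meanD a f g c d : arc_mean f c -> arc_mean g d -> arc_mean (a *: f + g) (a * c + d).
Proof.
move=> [S [S0 Spi dS]] [T [T0 Tpi dT]].
exists (fun t => a * S t + T t); split => [||t].
- by rewrite S0 T0 mulr0 addr0.
- by rewrite Spi Tpi mulr0 addr0.
have h1 := dS t; have h2 := dT t.
apply: is_derive_eq; rewrite !hornerE /GRing.scale /=; ring.
Qed.

(** [S t + c * t] is a primitive of [f (2 cos t)], so the mean value theorem takes the place of
    integration. *)
Lemma arc_increment f c (S : R -> R) x y M :
  (forall t : R, is_derive t 1 S (f.[2 * cos t] - c)) -> x <= y ->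
  (forall t, x <= t <= y -> f.[2 * cos t] <= M) ->
  S y + c * y - (S x + c * x) <= M * (y - x).
Proof.
move=> dS le_xy hM.
have dG (t : R) : is_derive t (1:R) (fun t => S t + c * t) f.[2 * cos t].
  by have h := dS t; apply: is_derive_eq; rewrite /GRing.scale /=; ring.
have cG : {within `[x, y], continuous (fun t => S t + c * t)}.
  apply: derivable_within_continuous => t _; exact: (@ex_derive _ _ _ _ _ _ _ (dG t)).
have [t + ->] := MVT_segment le_xy (fun t _ => dG t) cG.
by rewrite in_itv /= => /hM h; rewrite ler_wpM2r// subr_ge0.
Qed.

(** Comparison with a step function that jumps at [x]. As [cos] decreases on [[0, pi]], small [t]
    correspond to large arguments of [f]. *)
Lemma arc_mean_le f c x e : arc_mean f c -> 0 <= x <= pi ->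
  (forall t, 0 <= t <= x -> f.[2 * cos t] <= e) ->
  (forall t, x <= t <= pi -> f.[2 * cos t] <= 1) ->
  c * pi <= e * x + (pi - x).
Proof.
move=> [S [S0 Spi dS]] /andP[x0 xpi] h1 h2.
have := arc_increment dS x0 h1; have := arc_increment dS xpi h2.
rewrite S0 Spi; lra.
Qed.

Lemma arc_mean_ge f c x e : arc_mean f c -> 0 <= x <= pi ->
  (forall t, 0 <= t <= x -> 0 <= f.[2 * cos t]) ->
  (forall t, x <= t <= pi -> e <= f.[2 * cos t]) ->
  e * (pi - x) <= c * pi.
Proof.
move=> hf /andP[x0 xpi] h1 h2.
have [S [S0 Spi dS]] : arc_mean (- f) (- c).
  have := arc_meanD (-1) hf (arc_meanD (-1) arc_mean1 arc_mean1).
  by rewrite !scaleN1r !mulN1r !addNr !addr0.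
have H1 : S pi + - c * pi - (S x + - c * x) <= - e * (pi - x).
  by apply: arc_increment xpi _ => // t /h2; rewrite hornerN lerN2.
have H2 : S x + - c * x - (S 0 + - c * 0) <= 0 * (x - 0).
  by apply: arc_increment x0 _ => // t /h1; rewrite hornerN oppr_le0.
move: H1 H2; rewrite S0 Spi; lra.
Qed.

End ArcsineMean.

Section StepPolynomials.
Context {R : realType}.
Implicit Types (f : {poly R}) (t x eps : R).

Lemma bernoulli_ge x n : -1 <= x -> 1 + n%:R * x <= (1 + x) ^+ n.
Proof.
move=> hx; elim: n => [|n IH]; first by rewrite mul0r addr0 expr0.
rewrite exprS; apply: (@le_trans _ _ ((1 + x) * (1 + n%:R * x))).
  have : 0 <= n%:R * x ^+ 2 by rewrite mulr_ge0 ?sqr_ge0.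
  by rewrite -natr1; nra.
by apply: ler_wpM2l => //; lra.
Qed.

Lemma expr_lt_eps r eps : 0 <= r < 1 -> 0 < eps -> exists n, r ^+ n <= eps.
Proof.
move=> /andP[r0 r1] e0.
have : r ^+ n @[n --> \oo] --> (0 : R) by apply: cvg_expr; rewrite ger0_norm.
move=> /cvgrPdist_le /(_ _ e0) [N _ /(_ N)] /=; rewrite leqnn sub0r normrN => /(_ isT) h.
by exists N; rewrite (le_trans _ h)// ler_norm.
Qed.

(* The polynomials [(1 - u ^ n) ^ (2 ^ n)] tend to the indicator of [u < 1/2] on [0, 1],
   by Bernoulli's inequality. *)
Lemma step_poly (B t t' eps : R) : -B < t -> t < t' -> t' < B -> 0 < eps ->
  exists f, forall x, -B <= x <= B ->
   [/\ 0 <= f.[x] <= 1, x <= t -> 1 - eps <= f.[x] & t' <= x -> f.[x] <= eps].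
Proof.
move=> Bt tt' t'B e0.
(* The affine map [u] below has value 1/2 at [m] and slope [1 / (4B)], which keeps it in [[0, 1]]
   because [|x - m| <= 2B]. Its distance from 1/2 at [t] and at [t'] is [eta]. *)
pose m := (t + t') / 2; pose eta := (t' - t) / (8 * B).
have B0 : 0 < B by lra.
have eta0 : 0 < eta by rewrite divr_gt0//; lra.
have eta1 : eta < 1 / 2 by rewrite ltr_pdivrMr; lra.
have [n1 hn1] : exists n, (1 - 2 * eta) ^+ n <= eps by apply: expr_lt_eps => //; lra.
have [n2 hn2] : exists n, ((1 + 2 * eta)^-1) ^+ n <= eps.
  apply: expr_lt_eps => //; rewrite invr_ge0 invf_lt1; lra.
pose n := maxn n1 n2.
have {}hn1 : (1 - 2 * eta) ^+ n <= eps.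
  by apply: le_trans hn1; apply: ler_wiXn2l; [lra|lra|exact: leq_maxl].
have {}hn2 : ((1 + 2 * eta)^-1) ^+ n <= eps.
  apply: le_trans hn2; apply: ler_wiXn2l; rewrite ?leq_maxr//.
    by rewrite invr_ge0; lra.
  by rewrite invf_le1; lra.
pose u : {poly R} := (1/2)%:P + (4 * B)^-1 *: ('X - m%:P).
exists ((1 - u ^+ n) ^+ (2 ^ n)) => x /andP[Bx xB].
have ux : u.[x] = 1/2 + (4 * B)^-1 * (x - m) by rewrite /u !hornerE.
have fx : ((1 - u ^+ n) ^+ (2 ^ n)).[x] = (1 - u.[x] ^+ n) ^+ (2 ^ n).
  by rewrite !hornerE.
rewrite fx; set v := u.[x] in ux *.
have v01 : 0 <= v <= 1.
  have Bi : 0 < (4 * B)^-1 by rewrite invr_gt0; lra.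
  have BiB : (4 * B)^-1 * B = 1 / 4 by field; lra.
  rewrite ux /m; nra.
have [v0 v1] := andP v01.
have vn01 : 0 <= v ^+ n <= 1 by rewrite exprn_ge0// exprn_ile1.
have [vn0 vn1] := andP vn01.
have w01 : 0 <= 1 - v ^+ n <= 1 by lra.
have [w0 w1] := andP w01.
have eE : eta = (4 * B)^-1 * (t' - t) / 2 by rewrite /eta; field; lra.
have Bi : 0 < (4 * B)^-1 by rewrite invr_gt0; lra.
split.
- by rewrite exprn_ge0// exprn_ile1.
- move=> xt.
  (* Bernoulli leaves the error [(2v)^n], where [2v <= 1 - 2 eta]. *)
  apply: (@le_trans _ _ (1 + (2 ^ n)%:R * (- v ^+ n))); last by apply: bernoulli_ge; lra.
  have h : 2%:R * v <= 1 - 2 * eta by rewrite ux eE /m; nra.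
  rewrite mulrN lerB// natrX -exprMn; apply: le_trans hn1.
  by apply: lerXn2r => //; rewrite nnegrE; lra.
- move=> xt; rewrite (le_trans _ hn2)// exprVn -[_ ^- n]mul1r ler_pdivlMr; last by rewrite exprn_gt0; lra.
  (* The product is at most 1, while by Bernoulli its second factor is at least
     [(2v)^n >= (1 + 2 eta)^n]. *)
  apply: (@le_trans _ _ ((1 - v ^+ n) ^+ (2 ^ n) * (1 + v ^+ n) ^+ (2 ^ n))).
    apply: ler_wpM2l; first by rewrite exprn_ge0.
    apply: (@le_trans _ _ (1 + (2 ^ n)%:R * v ^+ n)); last by apply: bernoulli_ge; lra.
    have h : 1 + 2 * eta <= 2%:R * v by rewrite ux eE /m; nra.
    rewrite natrX -exprMn ler_wpDl//.
    by apply: lerXn2r => //; rewrite nnegrE; lra.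
  by rewrite -exprMn exprn_ile1//; nra.
Qed.

End StepPolynomials.

(** * Moments of the density of states *)

Section DosFunctional.
Context {R : realType}.
Variables (a b : int -> R) (p : nat).
Hypothesis a_gt0 : forall n, 0 < a n.
Hypothesis per : jperiodic a b p.
Hypothesis p_gt0 : (0 < p)%N.
Local Notation actJ := (pact a b).
Local Notation banded := (banded a b p).
Local Notation discrX := (discrX a b p).

(** The functional [q |-> int q dk], as a purely algebraic trace per period. *)
Definition dosL (q : {poly R}) : R :=
  p%:R^-1 * \sum_(n < p) actJ q (delta R (n : nat)%:Z) (n : nat)%:Z.

Lemma dosLD c q r : dosL (c *: q + r) = c * dosL q + dosL r.
Proof.
rewrite /dosL [c * _]mulrCA -mulrDr; congr (_ * _); rewrite mulr_sumr -big_split.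
by apply: eq_bigr => n _; rewrite pactDl pactZl.
Qed.

Lemma dosL_moments q : dosL q = \sum_(i < size q) q`_i * dos_moment a b p i.
Proof.
rewrite /dosL /dos_moment /pact exchange_big /= mulr_sumr; apply: eq_bigr => i _.
by rewrite -mulr_sumr mulrCA.
Qed.

Lemma dosL_diffquot y :
  dosL (diffquot a b p y) = - p%:R^-1 * \sum_(n < p) tprodE a b y (n : nat)%:Z p 0 1.
Proof.
by rewrite /dosL mulNr -mulrN -sumrN; congr (_ * _); apply: eq_bigr => n _; rewrite diffquot_diag.
Qed.

Lemma comp_cheb n : cheb n \Po discrX = chebX a b p n.
Proof.
elim/ltn_ind: n => -[|[|n]] IH; [exact: comp_polyC|exact: comp_polyX|].
by rewrite chebSS comp_polyB comp_polyM comp_polyX !IH.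
Qed.

Lemma dosL_cheb w n : banded w -> (0 < n)%N -> dosL (w * chebX a b p n) = 0.
Proof.
by move=> bw n0; rewrite /dosL big1 ?mulr0// => i _; rewrite banded_cheb.
Qed.

(** One [c] has to serve all banded weights [w] at once; the property is then stable under linear
    combinations. *)
Let arc_good (f : {poly R}) := exists c, arc_mean f c /\
  forall w, banded w -> dosL (w * (f \Po discrX)) = c * dosL w.

Let arc_goodD k f g : arc_good f -> arc_good g -> arc_good (k *: f + g).
Proof.
move=> [c [hc Hc]] [d [hd Hd]]; exists (k * c + d); split; first exact: arc_meanD.
move=> w bw; rewrite comp_polyD comp_polyZ mulrDr -scalerAr dosLD Hc// Hd//; ring.
Qed.

Lemma dosL0 : dosL 0 = 0.
Proof. by rewrite dosL_moments size_poly0 big_ord0. Qed.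

Let arc_good0 : arc_good 0.
Proof.
exists 0; split.
  by have := arc_meanD (-1) (arc_mean1 (R:=R)) (arc_mean1 (R:=R)); rewrite scaleN1r mulN1r !addNr.
by move=> w _; rewrite comp_poly0 mulr0 mul0r dosL0.
Qed.

Let arc_good_cheb n : arc_good (cheb n).
Proof.
case: n => [|n].
  rewrite (_ : cheb 0 = (2 : R) *: (1 : {poly R}) + 0); last by rewrite addr0 /= -alg_polyC.
  apply: arc_goodD => //; exists 1; split; first exact: arc_mean1.
  by move=> w _; rewrite comp_polyC mulr1 mul1r.
exists 0; split; first exact: arc_mean_cheb.
by move=> w bw; rewrite comp_cheb dosL_cheb// mul0r.
Qed.

(* Under [w dk] the discriminant is arcsine distributed. *)
Lemma dosL_comp_discr f : exists c, arc_mean f c /\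
  forall w, banded w -> dosL (w * (f \Po discrX)) = c * dosL w.
Proof.
rewrite -/(arc_good f).
(* Monomials are expanded in Chebyshev polynomials by induction on [m]:
   [X * cheb (n+1) = cheb (n+2) + cheb n], and [X * cheb 0 = 2 * cheb 1]. *)
have XC m n : arc_good ('X^m * cheb n).
  elim: m n => [|m IH] n; first by rewrite expr0 mul1r.
  case: n => [|n].
    rewrite (_ : ('X^(m.+1) * cheb 0)%R = 1%R *: ('X^m * cheb 1) + 'X^m * cheb 1 :> {poly R}).
      exact: arc_goodD.
    by rewrite scale1r /= exprSr -mulrDr -mulrA; congr (_ * _); rewrite polyC_natr; ring.
  rewrite (_ : ('X^(m.+1) * cheb n.+1)%R = 1%R *: ('X^m * cheb n.+2) + 'X^m * cheb n :> {poly R}).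
    exact: arc_goodD.
  by rewrite scale1r chebSS exprSr; ring.
(* The factor 1/2 compensates [cheb 0 = 2]. *)
have X0 m : arc_good ('X^m).
  rewrite (_ : 'X^m = (1/2) *: ('X^m * cheb 0) + 0 :> {poly R}); first exact: arc_goodD.
  by rewrite addr0 /= [_ * 2%:P]mulrC mul_polyC scalerA mul1r mulVf ?scale1r// pnatr_eq0.
rewrite -[f]coefK poly_def; apply: big_ind => // [g h Hg Hh|i _].
  by rewrite -[g]scale1r; apply: arc_goodD.
by rewrite -[_ *: _]addr0; apply: arc_goodD.
Qed.

End DosFunctional.

(** * Distribution of the discriminant *)

Section IntegratedDensity.
Context {R : realType}.
Variables (mu : {measure set R -> \bar R}) (B : R).
Hypothesis mu_fin : (mu setT < +oo)%E.
Implicit Types (A : set R) (q r w D : {poly R}).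

(** On this bounded set every polynomial is bounded, hence integrable for the finite measure
    [mu]. *)
Definition window : set R := [set x | `|x| <= B].

Definition pint A q : R := \int[mu]_(x in window `&` A) q.[x].

Lemma measurable_horner q : measurable_fun setT (horner q).
Proof. by apply: continuous_measurable_fun; exact: continuous_horner. Qed.

Lemma measurable_horner_itv q (i : interval R) : measurable [set x | q.[x] \in i].
Proof.
have := measurable_horner q measurableT (measurable_itv i).
by rewrite setTI.
Qed.

Lemma measurable_window : measurable window.
Proof.
rewrite /window (_ : [set x | _] = [set x | ('X : {poly R}).[x] \in `[-B, B]]).
  exact: measurable_horner_itv.
by apply/seteqP; split => x /=; rewrite hornerX in_itv /= ler_norml.
Qed.

Lemma horner_bounded q : exists M, forall x, window x -> `|q.[x]| <= M.
Proof.
elim/poly_ind: q => [|q c [M IH]]; first by exists 0 => x _; rewrite horner0 normr0.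
exists (M * B + `|c|) => x Bx; rewrite hornerMXaddC.
rewrite (le_trans (ler_normD _ _))// lerD2r normrM ler_pM//; exact: IH.
Qed.

Lemma pint_measurable A : measurable A -> measurable (window `&` A).
Proof. by move=> mA; apply: measurableI => //; exact: measurable_window. Qed.

Lemma pint_integrable A q : measurable A ->
  mu.-integrable (window `&` A) (EFin \o horner q).
Proof.
move=> mA; apply: measurable_bounded_integrable; first exact: pint_measurable.
- apply: le_lt_trans mu_fin; apply: le_measure; rewrite ?inE//; exact: pint_measurable.
- exact: measurable_funTS (measurable_horner q).
have [M hM] := horner_bounded q.
exists M; split; first by rewrite num_real.
by move=> N MN x [Bx _] /=; rewrite (le_trans (hM x Bx))// ltW.
Qed.

Lemma pintD A c q r : measurable A -> pint A (c *: q + r) = c * pint A q + pint A r.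
Proof.
move=> mA; rewrite /pint -RintegralZl; [|exact: pint_measurable|exact: pint_integrable].
rewrite -RintegralD; [|exact: pint_measurable| |exact: pint_integrable].
  by apply: eq_Rintegral => x _; rewrite !hornerE.
rewrite (_ : _ \o _ = EFin \o horner (c *: q)); first exact: pint_integrable.
by apply/funext => x /=; rewrite hornerZ.
Qed.

Lemma pint_le A q r : measurable A ->
  (forall x, window x -> A x -> q.[x] <= r.[x]) -> pint A q <= pint A r.
Proof.
move=> mA h; apply: le_Rintegral; [exact: pint_measurable|exact: pint_integrable..|].
by move=> x [Bx Ax]; exact: h.
Qed.

Lemma pint0 A : pint A 0 = 0.
Proof.
rewrite /pint /Rintegral (_ : (fun x => _) = cst 0%E) ?integral0//.
by apply/funext => x; rewrite horner0.
Qed.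

Lemma pint_ge0 A q : (forall x, window x -> A x -> 0 <= q.[x]) -> 0 <= pint A q.
Proof. by move=> h; apply: Rintegral_ge0 => x [Bx Ax]; exact: h. Qed.

Lemma pint_setU A A' q : measurable A -> measurable A' -> [disjoint A & A'] ->
  pint (A `|` A') q = pint A q + pint A' q.
Proof.
move=> mA mA' dA; rewrite /pint setIUr Rintegral_setU//; try exact: pint_measurable.
  by rewrite -setIUr; apply: pint_integrable; exact: measurableU.
move/disj_setPS: dA => dA; apply/disj_setPS => x [[_ Ax] [_ A'x]]; exact: dA.
Qed.

Lemma pint_split A q : measurable A -> pint setT q = pint A q + pint (~` A) q.
Proof.
move=> mA; rewrite -pint_setU//; [by rewrite setUv|exact: measurableC|].
by apply/disj_setPS => x [].
Qed.

(** The distribution function of the arcsine law on [[-2, 2]]: the proportion of [x] in [[0, pi]]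
    with [2 cos x <= t]. *)
Definition arc_cdf (t : R) : R := 1 - acos (t / 2) / pi.

Lemma is_derive_arc_cdf (t : R) : -2 < t < 2 ->
  is_derive t (1:R) arc_cdf (2 * pi * Num.sqrt (1 - (t / 2) ^+ 2))^-1.
Proof.
move=> /andP[t1 t2].
have h : is_derive (t * 2^-1) 1 (@acos R) (- (Num.sqrt (1 - (t / 2) ^+ 2))^-1).
  by apply: is_derive1_acos; lra.
have g' : is_derive t (1:R) (fun t => t * 2^-1) 2^-1.
  by apply: is_derive_eq; rewrite /GRing.scale /=; ring.
have h' : is_derive t (1:R) (fun t => acos (t / 2)) (- (Num.sqrt (1 - (t / 2) ^+ 2))^-1 * 2^-1).
  exact: (@is_derive1_comp _ (@acos R) (fun t => t * 2^-1) t _ _ h g').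
rewrite /arc_cdf; apply: is_derive_eq.
rewrite /GRing.scale /= !invfM; ring.
Qed.

Variables (D w : {poly R}).
Hypothesis w_ge0 : forall x, window x -> 0 <= w.[x].
Hypothesis arc : forall f, exists c, arc_mean f c /\ pint setT (w * (f \Po D)) = c * pint setT w.

Let pi0 : 0 < pi :> R := pi_gt0 R.

Lemma acos_itv (t : R) : -2 < t < 2 -> 0 <= acos (t / 2) <= pi.
Proof. by move=> h; rewrite acos_ge0 ?acos_lepi//; lra. Qed.

Lemma cos_ge_acos (t x : R) : -2 < t < 2 -> 0 <= x <= acos (t / 2) -> t <= 2 * cos x.
Proof.
move=> ht /andP[x0 hx]; have /andP[a0 api] := acos_itv ht.
have : cos (acos (t / 2)) = t / 2 by rewrite acosK// in_itv /=; lra.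
move: hx; rewrite le_eqVlt => /predU1P[<- ->|hx]; first lra.
suff : cos (acos (t / 2)) < cos x by lra.
by rewrite ltr_cos// in_itv /=; lra.
Qed.

Lemma cos_le_acos (t x : R) : -2 < t < 2 -> acos (t / 2) <= x <= pi -> 2 * cos x <= t.
Proof.
move=> ht /andP[hx xpi]; have /andP[a0 api] := acos_itv ht.
have : cos (acos (t / 2)) = t / 2 by rewrite acosK// in_itv /=; lra.
move: hx; rewrite le_eqVlt => /predU1P[<- ->|hx]; first lra.
suff : cos x < cos (acos (t / 2)) by lra.
by rewrite ltr_cos// in_itv /=; lra.
Qed.

Lemma measurable_le (t : R) : measurable [set x | D.[x] <= t].
Proof.
have := measurable_horner_itv D `]-oo, t].
by under eq_set do rewrite in_itv /=.
Qed.

Lemma measurable_lt (t : R) : measurable [set x | D.[x] < t].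
Proof.
have := measurable_horner_itv D `]-oo, t[.
by under eq_set do rewrite in_itv /=.
Qed.

Lemma step_discr (t t' eps : R) : -2 < t -> t < t' -> t' < 2 -> 0 < eps ->
  exists f, [/\ forall x, window x -> [/\ 0 <= f.[D.[x]] <= 1,
     D.[x] <= t -> 1 - eps <= f.[D.[x]] & t' <= D.[x] -> f.[D.[x]] <= eps]
  & forall x, -2 <= x <= 2 -> [/\ 0 <= f.[x] <= 1,
     x <= t -> 1 - eps <= f.[x] & t' <= x -> f.[x] <= eps]].
Proof.
move=> ht tt' ht' e0; have [M hM] := horner_bounded D.
(* The radius [max 3 M] covers both the values of [D] on the window and the interval [[-2, 2]] of
   the values [2 cos x]. *)
have h1 : - Num.max 3 M < t by rewrite ltrNl lt_max; apply/orP; left; lra.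
have h2 : t' < Num.max 3 M by rewrite lt_max; apply/orP; left; lra.
have [f hf] := step_poly h1 tt' h2 e0.
exists f; split => x.
  move=> /hM h; apply: hf; rewrite -ler_norml (le_trans h)// le_max lexx orbT//.
by move=> h; apply: hf; rewrite -ler_norml le_max; apply/orP; left; rewrite ler_norml; lra.
Qed.

(** A step polynomial [f] falls from about 1 to about 0 between [t] and [t']. The integral of
    [w * f(D)] dominates nearly all of the mass below [t], and it equals [c] times the total, where
    [c] is bounded on the arcsine side. *)
Lemma pint_le_approx (t t' eps : R) : -2 < t -> t < t' -> t' < 2 -> 0 < eps ->
  (1 - eps) * pint [set x | D.[x] <= t] w <= (arc_cdf t' + eps) * pint setT w.
Proof.
move=> ht tt' ht' e0; have [f [hD hf]] := step_discr ht tt' ht' e0.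
have [c [mc Ec]] := arc f.
have wT : 0 <= pint setT w by apply: pint_ge0 => x Bx _; exact: w_ge0.
have t'2 : -2 < t' < 2 by lra.
have hc : c <= arc_cdf t' + eps.
  have /andP[a0 api] := acos_itv t'2.
  have : c * pi <= eps * acos (t' / 2) + (pi - acos (t' / 2)).
    apply: arc_mean_le mc _ _ _; first by rewrite a0.
      move=> x hx; have [] := hf (2 * cos x); first by have := cos_le1 x; have := cos_geN1 x; lra.
      by move=> _ _; apply; apply: cos_ge_acos.
    move=> x hx; have [] := hf (2 * cos x); first by have := cos_le1 x; have := cos_geN1 x; lra.
    by case/andP.
  move=> h; rewrite /arc_cdf -(ler_pM2r pi0) (mulrDl (1 - _)) mulrBl divfK ?gt_eqF// mul1r.
  apply: le_trans h _; have : eps * acos (t' / 2) <= eps * pi by rewrite ler_pM2l.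
  lra.
apply: (@le_trans _ _ (c * pint setT w)); last by rewrite ler_wpM2r.
rewrite -Ec (pint_split _ (measurable_le t)).
apply: (@le_trans _ _ (pint [set x | D.[x] <= t] (w * (f \Po D)))).
  rewrite -[_ * pint _ w]addr0 -(pint0 [set x | D.[x] <= t]) -pintD; last exact: measurable_le.
  apply: pint_le; first exact: measurable_le.
  move=> x Bx /= Dx; rewrite !hornerE horner_comp mulrC ler_wpM2l ?w_ge0//.
  by have [_ h _] := hD x Bx; apply: h.
rewrite lerDl; apply: pint_ge0 => x Bx _; rewrite hornerM horner_comp mulr_ge0 ?w_ge0//.
by have [/andP[]] := hD x Bx.
Qed.

(** The same step polynomial, with the roles exchanged: [c] is bounded below by the arcsine law, and
    where [D >= t'] the integrand is at most [eps * w]. *)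
Lemma pint_lt_approx (t t' eps : R) : -2 < t -> t < t' -> t' < 2 -> 0 < eps ->
  (1 - eps) * arc_cdf t * pint setT w <= pint [set x | D.[x] < t'] w + eps * pint setT w.
Proof.
move=> ht tt' ht' e0; have [f [hD hf]] := step_discr ht tt' ht' e0.
have [c [mc Ec]] := arc f.
have wT : 0 <= pint setT w by apply: pint_ge0 => x Bx _; exact: w_ge0.
have t2 : -2 < t < 2 by lra.
have hc : (1 - eps) * arc_cdf t <= c.
  have /andP[a0 api] := acos_itv t2.
  have : (1 - eps) * (pi - acos (t / 2)) <= c * pi.
    apply: arc_mean_ge mc _ _ _; first by rewrite a0.
      move=> x hx; have [] := hf (2 * cos x); first by have := cos_le1 x; have := cos_geN1 x; lra.
      by case/andP.
    move=> x hx; have [] := hf (2 * cos x); first by have := cos_le1 x; have := cos_geN1 x; lra.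
    by move=> _ h _; apply: h; apply: cos_le_acos.
  move=> h; rewrite -(ler_pM2r pi0) (le_trans _ h)// /arc_cdf -mulrA.
  have -> : (1 - acos (t / 2) / pi) * pi = pi - acos (t / 2) by rewrite mulrBl mul1r divfK// gt_eqF.
  by [].
apply: (@le_trans _ _ (c * pint setT w)); first by rewrite ler_wpM2r.
rewrite -Ec (pint_split _ (measurable_lt t')) [X in _ <= _ + _ * X](pint_split _ (measurable_lt t')).
have e1 : pint [set x | D.[x] < t'] (w * (f \Po D)) <= pint [set x | D.[x] < t'] w.
  apply: pint_le; first exact: measurable_lt.
  move=> x Bx _; rewrite hornerM horner_comp ler_piMr ?w_ge0//.
  by have [/andP[]] := hD x Bx.
have mC : measurable (~` [set x | D.[x] < t']) by apply: measurableC; exact: measurable_lt.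
have e2 : pint (~` [set x | D.[x] < t']) (w * (f \Po D)) <= eps * pint (~` [set x | D.[x] < t']) w.
  rewrite -[_ * pint _ w]addr0 -(pint0 (~` [set x | D.[x] < t'])) -pintD//.
  apply: pint_le => // x Bx /= /negP; rewrite -leNgt => Dx.
  rewrite !hornerE horner_comp [leRHS]mulrC ler_wpM2l ?w_ge0//.
  by have [_ _ h] := hD x Bx; apply: h.
have e3 : 0 <= eps * pint [set x | D.[x] < t'] w.
  by apply: mulr_ge0; [exact: ltW|apply: pint_ge0 => x Bx _; exact: w_ge0].
by rewrite mulrDr; lra.
Qed.

Lemma arc_cdf_cont (t e : R) : -2 < t < 2 -> 0 < e -> exists2 d, 0 < d &
  forall t', `|t - t'| < d -> `|arc_cdf t - arc_cdf t'| <= e.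
Proof.
move=> ht e0; have h := is_derive_arc_cdf ht.
have : {for t, continuous arc_cdf}.
  by apply: differentiable_continuous; apply/derivable1_diffP; exact: (@ex_derive _ _ _ _ _ _ _ h).
by move=> /cvgrPdist_le /(_ e e0) /nbhs_ballP [d /= d0 hd]; exists d => // t' /hd.
Qed.

(** Let the step width and [eps] tend to 0 in the two approximate bounds. As the limit [arc_cdf] is
    continuous, the closed and the open sublevel sets are squeezed to the same value. *)
Lemma pint_cdf (t : R) : -2 < t < 2 ->
  pint [set x | D.[x] <= t] w = arc_cdf t * pint setT w /\
  pint [set x | D.[x] < t] w = arc_cdf t * pint setT w.
Proof.
move=> ht; have /andP[ht1 ht2] := ht.
have wT : 0 <= pint setT w by apply: pint_ge0 => x Bx _; exact: w_ge0.
have lt_le : pint [set x | D.[x] < t] w <= pint [set x | D.[x] <= t] w.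
  rewrite (_ : [set x | D.[x] <= t] = [set x | D.[x] < t] `|` [set x | D.[x] \in `[t, t]]).
    rewrite pint_setU; [|exact: measurable_lt|exact: measurable_horner_itv|].
      by rewrite lerDl; apply: pint_ge0 => x Bx _; exact: w_ge0.
    by apply/disj_setPS => x [] /= h; rewrite in_itv /=; lra.
  apply/seteqP; split => x /=; rewrite in_itv /=.
    by have [lt_Dt|le_tD] := ltP D.[x] t; [left|right; rewrite ?le_tD].
  by case=> [/ltW//|/andP[]].
have up : pint [set x | D.[x] <= t] w <= arc_cdf t * pint setT w.
  set X := pint [set x | D.[x] <= t] w; set Y := pint _ _ in wT *.
  apply/ler_addgt0Pr => e e0.
  (* The errors are [e' X] from the factor [1 - e'], and [e' Y] twice, from the step and from the
     continuity of [arc_cdf]. The summand 1 keeps the denominator positive. *)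
  pose e' := e / (1 + `|X| + 2 * Y).
  have n0 : 0 < 1 + `|X| + 2 * Y by have := normr_ge0 X; lra.
  have e'0 : 0 < e' by rewrite divr_gt0.
  have [d d0 hd] := arc_cdf_cont ht e'0.
  pose t' := t + Num.min (d / 2) ((2 - t) / 2).
  have m0 : 0 < Num.min (d / 2) ((2 - t) / 2) by rewrite lt_min; lra.
  have m1 : Num.min (d / 2) ((2 - t) / 2) <= d / 2 by rewrite ge_min lexx.
  have m2 : Num.min (d / 2) ((2 - t) / 2) <= (2 - t) / 2 by rewrite ge_min lexx orbT.
  have tt' : t < t' by rewrite /t'; lra.
  have t'2 : t' < 2 by rewrite /t'; lra.
  have dt : `|t - t'| < d by rewrite ler0_norm /t'; lra.
  have := hd _ dt; rewrite ler_norml => /andP[h1 h2].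
  have := pint_le_approx ht1 tt' t'2 e'0; rewrite -/X -/Y => h3.
  have h4 : arc_cdf t' * Y <= (arc_cdf t + e') * Y by rewrite ler_wpM2r//; lra.
  have h5 : e' * (1 + `|X| + 2 * Y) = e by rewrite divfK// gt_eqF.
  have h6 : e' * X <= e' * `|X| by rewrite ler_pM2l// ler_norm.
  by move: h3 h4 h5 h6 e'0; clearbody e' X Y => h3 h4 h5 h6 e0'; nra.
have lo : arc_cdf t * pint setT w <= pint [set x | D.[x] < t] w.
  set X := pint [set x | D.[x] < t] w; set Y := pint _ _ in wT *.
  apply/ler_addgt0Pr => e e0.
  (* Here each of the three errors is at most [e' Y], as [arc_cdf t' <= 1]. *)
  pose e' := e / (1 + 3 * Y).
  have n0 : 0 < 1 + 3 * Y by lra.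
  have e'0 : 0 < e' by rewrite divr_gt0.
  have [d d0 hd] := arc_cdf_cont ht e'0.
  pose t' := t - Num.min (d / 2) ((t + 2) / 2).
  have m0 : 0 < Num.min (d / 2) ((t + 2) / 2) by rewrite lt_min; lra.
  have m1 : Num.min (d / 2) ((t + 2) / 2) <= d / 2 by rewrite ge_min lexx.
  have m2 : Num.min (d / 2) ((t + 2) / 2) <= (t + 2) / 2 by rewrite ge_min lexx orbT.
  have tt' : t' < t by rewrite /t'; lra.
  have t'2 : -2 < t' by rewrite /t'; lra.
  have dt : `|t - t'| < d by rewrite ger0_norm /t'; lra.
  have := hd _ dt; rewrite ler_norml => /andP[h1 h2].
  have := pint_lt_approx t'2 tt' ht2 e'0; rewrite -/X -/Y => h3.
  have h4 : (arc_cdf t - e') * Y <= arc_cdf t' * Y by rewrite ler_wpM2r//; lra.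
  have h5 : e' * (1 + 3 * Y) = e by rewrite divfK// gt_eqF.
  have h6 : e' * (arc_cdf t' * Y) <= e' * Y.
    rewrite ler_pM2l// ler_piMl// /arc_cdf gerBl divr_ge0 ?pi_ge0//.
    by have /andP[] : 0 <= acos (t' / 2) <= pi by apply: acos_itv; lra.
  by move: h3 h4 h5 h6 e'0; clearbody e' X Y => h3 h4 h5 h6 e0'; nra.
by split; apply/eqP; rewrite eq_le; lra.
Qed.

End IntegratedDensity.

(** * Local density *)

Section LocalDensity.
Context {R : realType}.
Variables (mu : {measure set R -> \bar R}) (B : R).
Hypothesis mu_fin : (mu setT < +oo)%E.
Hypothesis mu_out : mu [set x : R | B < `|x|] = 0%E.
Local Notation pintB := (pint mu B).
Local Notation windowB := (window B).
Local Notation level D s t := [set x | D.[x] \in `[s, t]].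
Let mlevel (D : {poly R}) s t : measurable (level D s t) := measurable_horner_itv D `[s, t].
Let mitv (i : interval R) : measurable [set x | x \in i] := measurable_itv i.

Lemma pint_const A c : measurable A -> pintB A c%:P = c * pintB A 1.
Proof.
move=> mA; rewrite -[c%:P]addr0 -alg_polyC pintD// (_ : pintB A 0 = 0) ?addr0//.
exact: pint0.
Qed.

Lemma pint1_ge0 A : 0 <= pintB A 1.
Proof. by apply: pint_ge0 => x _ _; rewrite hornerC. Qed.

Lemma pint1_subset A A' : measurable A -> measurable A' -> A `<=` A' -> pintB A 1 <= pintB A' 1.
Proof.
move=> mA mA' AA'; rewrite -(setDUK AA') pint_setU//; last by apply/disj_setPS => x [? []].
- by rewrite lerDl pint1_ge0.
- exact: measurableD.
Qed.

Lemma pint1E A : measurable A -> pintB A 1 = fine (mu A).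
Proof.
move=> mA; have mC : measurable (~` windowB) by apply: measurableC; exact: measurable_window.
rewrite /pint (eq_Rintegral _ (g := cst 1)); last by move=> x _; rewrite hornerC.
rewrite Rintegral_cst ?mul1r; last exact: pint_measurable.
congr fine; rewrite [windowB `&` A]setIC [RHS](measureDI _ mA (measurable_window B)).
rewrite -[LHS]add0e; congr (_ + _)%E; apply/esym.
have W : ~` windowB = [set x : R | B < `|x|].
  by apply/seteqP; split => x /=; rewrite /window /= ltNge => /negP.
apply: (@subset_measure0 _ _ _ _ _ (~` windowB)) => //; [|by rewrite W].
by apply: measurableD => //; exact: measurable_window.
Qed.

Lemma ids_pint E : ids mu E = pintB [set x | x \in `]-oo, E]] 1.
Proof.
by rewrite pint1E// /ids; congr (fine (mu _)); apply/seteqP; split => x /=; rewrite in_itv.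
Qed.

Variables (D K : {poly R}) (y kappa h l r : R) (H : R -> R).
Hypothesis DK : K * ('X - y%:P) = D - D.[y]%:P.
Hypothesis lyr : l < D.[y] < r.
Hypothesis level1 : forall s t, l < s -> s <= t -> t < r -> pintB (level D s t) 1 = H t - H s.
Hypothesis levelK : forall s t, l < s -> s <= t -> t < r -> pintB (level D s t) K = kappa * (H t - H s).
Hypothesis dH : is_derive D.[y] (1:R) H h.
Hypothesis h_gt0 : 0 < h.
Hypothesis kappa_gt0 : 0 < kappa.

Let near_set d := [set x | x \in `]y - d, y + d[].

Let DKE x : D.[x] - D.[y] = K.[x] * (x - y).
Proof. by have /(congr1 (horner^~ x)) := DK; rewrite !hornerE. Qed.

(** The integral of [K] over a thin level set is split at distance [d] from [y]. Near [y], [K] is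
    within [eta / 2] of [K.[y]]; farther away [K = (D - D.[y]) / (x - y)] is at most [eta / 2] in
    absolute value. *)
Lemma level_near_bound eta : 0 < eta -> exists2 d0, 0 < d0 & forall d, 0 < d <= d0 ->
  exists2 e, 0 < e & forall s t, l < s -> s <= D.[y] <= t -> t < r -> D.[y] - e <= s -> t <= D.[y] + e ->
  `|kappa * (H t - H s) - K.[y] * pintB (level D s t `&` near_set d) 1| <= eta * (H t - H s).
Proof.
move=> eta0; have eta2 : 0 < eta / 2 by lra.
have /cvgrPdist_le /(_ _ eta2) /nbhs_ballP [d0 /= d00 hd0] := @continuous_horner _ K y.
(* Dividing [|D.[x] - D.[y]| <= eta / 2 * d] by [|x - y| >= d] gives the bound [eta / 2] for [K]. *)
exists d0 => // d /andP[d_gt0 dd0]; exists (eta / 2 * d); first by rewrite mulr_gt0.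
move=> s t ls /andP[sy yt] tr hs ht.
have st := le_trans sy yt.
have mL := mlevel D s t.
pose A := level D s t `&` near_set d; pose A' := level D s t `\` near_set d.
have mN : measurable (near_set d) by exact: mitv.
have mA : measurable A by exact: measurableI.
have mA' : measurable A' by exact: measurableD.
have AA' : level D s t = A `|` A' by rewrite /A /A' setUIDK.
have dAA' : [disjoint A & A'] by apply/disj_setPS => x [[_ h1] [_ h2]].
have := level1 ls st tr; have := levelK ls st tr.
rewrite AA' !pint_setU// => EK E1; rewrite -AA' -/A.
have b1 x : A' x -> - (eta / 2) <= K.[x] <= eta / 2.
  rewrite /A' /near_set /= !in_itv /= => -[/andP[h1 h2]] h3; rewrite -ler_norml.
  have h4 : d <= `|x - y|.
    by rewrite leNgt; apply/negP => h4; apply: h3; move: h4; rewrite ltr_norml; lra.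
  have d1 : 0 < `|x - y| by lra.
  rewrite -(ler_pM2r d1) -normrM -DKE; apply: (@le_trans _ _ (eta / 2 * d)).
    by rewrite ler_norml; lra.
  by rewrite ler_pM2l.
have b2 x : A x -> K.[y] - eta / 2 <= K.[x] <= K.[y] + eta / 2.
  rewrite /A /near_set /= !in_itv /= => -[_ h1].
  have /hd0 : ball y d0 x by rewrite /ball /= ltr_norml; lra.
  by rewrite ler_norml /=; lra.
have n1 : pintB A' K <= eta / 2 * pintB A' 1 /\ - (eta / 2) * pintB A' 1 <= pintB A' K.
  by rewrite -!pint_const//; split; apply: pint_le => // x _ /b1; rewrite hornerC => /andP[].
have n2 : pintB A K <= (K.[y] + eta / 2) * pintB A 1 /\ (K.[y] - eta / 2) * pintB A 1 <= pintB A K.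
  by rewrite -!pint_const//; split; apply: pint_le => // x _ /b2; rewrite hornerC => /andP[].
have p1 := pint1_ge0 A; have p2 := pint1_ge0 A'.
rewrite -EK -E1 ler_norml; case: n1 n2 => n1 n1' [n2 n2'].
by apply/andP; split; nra.
Qed.

Lemma difference_quotientE (f : R -> R) (x : R) :
  (fun t => t^-1 *: ((f \o shift x) (t *: (1 : R)) - f x)) = (fun t => t^-1 * (f (t + x) - f x)).
Proof. by apply/funext => t; rewrite /= [t *: 1]mulr1. Qed.

Lemma quotient_derive_cvg (f : R -> R) (x df : R) : is_derive x (1:R) f df ->
  (fun t => t^-1 * (f (t + x) - f x)) @ 0^' --> df.
Proof. by case=> + <-; rewrite /derivable /derive difference_quotientE. Qed.

Lemma quotient_cvg_derive (f : R -> R) (x df : R) :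
  (fun t => t^-1 * (f (t + x) - f x)) @ 0^' --> df -> is_derive x (1:R) f df.
Proof.
move=> c; split; rewrite /derivable /derive difference_quotientE.
- exact: cvgP c.
- exact: cvg_lim.
Qed.

(** With tolerance [kappa / 2], [level_near_bound] makes [K.[y]] times a nonnegative mass at least
    [kappa / 2 * (H t - H s)], which is positive for a small level set because [h > 0]. *)
Lemma slope_gt0 : 0 < K.[y].
Proof.
have k2 : 0 < kappa / 2 by rewrite divr_gt0.
have [d0 d00 /(_ d0)] := level_near_bound k2.
rewrite d00 lexx => /(_ isT) [e e0 He].
have := quotient_derive_cvg dH => /cvgrPdist_lt /(_ h h_gt0) /nbhs_ballP [e' /= e'0 He'].
have /andP[ly yr] := lyr.
pose m := Num.min (e / 2) (Num.min (e' / 2) ((r - D.[y]) / 2)).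
have m0 : 0 < m by rewrite !lt_min; lra.
have m1 : m <= e / 2 by rewrite /m ge_min lexx.
have m2 : m <= e' / 2 by rewrite /m !ge_min lexx orbT.
have m3 : m <= (r - D.[y]) / 2 by rewrite /m !ge_min lexx !orbT.
clearbody m.
have dH0 : 0 < H (m + D.[y]) - H D.[y].
  have := He' m; rewrite /ball /= sub0r normrN gtr0_norm// => H1.
  have {}H1 := H1 ltac:(lra) ltac:(by rewrite gt_eqF).
  have : 0 < m^-1 * (H (m + D.[y]) - H D.[y]) by move: H1; rewrite ltr_norml; lra.
  by rewrite pmulr_rgt0// invr_gt0.
have := He D.[y] (m + D.[y]) ly _ _ _ _; rewrite lexx lerDr (ltW m0) => H1.
have {H1} := H1 isT ltac:(lra) ltac:(lra) ltac:(lra).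
rewrite ler_norml => /andP[_ H1].
have H2 : 0 < K.[y] * pintB (level D D.[y] (m + D.[y]) `&` near_set d0) 1 by nra.
have := pint1_ge0 (level D D.[y] (m + D.[y]) `&` near_set d0).
rewrite le_eqVlt => /predU1P[H3|H3]; first by move: H2; rewrite -H3 mulr0 ltxx.
by move: H2; rewrite pmulr_lgt0.
Qed.

Lemma deriv_slope : D^`().[y] = K.[y].
Proof.
have /(congr1 (fun q : {poly R} => q^`().[y])) := DK.
rewrite derivM derivXsubC derivB derivC subr0 => <-.
by rewrite !hornerE; ring.
Qed.

Lemma increasing_near : exists2 d, 0 < d &
  forall u v, u \in `]y - d, y + d[ -> v \in `]y - d, y + d[ -> u < v -> D.[u] < D.[v].
Proof.
have DyK := deriv_slope.
have K0 := slope_gt0.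
have /cvgrPdist_lt /(_ _ K0) /nbhs_ballP [d /= d0 hd] := @continuous_horner _ D^`() y.
exists d => // u v hu hv uv.
have dD x : x \in `]u, v[ -> is_derive x (1:R) (horner D) D^`().[x].
  by move=> _; rewrite derivE derive1E; apply: derivableP; exact: derivable_horner.
have cD : {within `[u, v], continuous (horner D)}.
  by apply: continuous_subspaceT; exact: continuous_horner.
have [c + Ec] := MVT uv dD cD.
rewrite -subr_gt0 Ec in_itv /= => /andP[uc cv].
rewrite mulr_gt0 ?subr_gt0//; have := hd c; rewrite /ball /= DyK => H1.
move: hu hv; rewrite !in_itv /= => /andP[u1 u2] /andP[v1 v2].
have {}H1 := H1 ltac:(by rewrite ltr_norml; lra).
by move: H1; rewrite ltr_norml; lra.
Qed.

(** The point lies in the level set of the single value [D.[E]], which has mass [H D.[E] - H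
    D.[E]]. *)
Lemma pint_point E : l < D.[E] < r -> pintB [set x | x \in `[E, E]] 1 = 0.
Proof.
move=> /andP[lE Er]; apply/eqP; rewrite eq_le pint1_ge0 andbT.
rewrite -[leRHS](subrr (H D.[E])) -level1//; apply: pint1_subset => //.
by move=> x /=; rewrite in_itv /= -eq_le => /eqP <-; rewrite in_itv /= lexx.
Qed.

Lemma ids_increment E1 E2 : E1 <= E2 -> l < D.[E1] < r ->
  ids mu E2 - ids mu E1 = pintB [set x | x \in `[E1, E2]] 1.
Proof.
move=> E12 hE; rewrite !ids_pint.
have split E : E1 <= E -> pintB [set x | x \in `]-oo, E]] 1 =
    pintB [set x | x \in `]-oo, E1[] 1 + pintB [set x | x \in `[E1, E]] 1.
  move=> hE1; rewrite -pint_setU//.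
    congr (pint _ _ _ _); apply/seteqP; split => x /=; rewrite !in_itv /=; first lra.
    by lra.
  by apply/disj_setPS => x [] /=; rewrite !in_itv /=; lra.
by rewrite (split E2)// (split E1)// (pint_point hE); ring.
Qed.

(** As [D] increases near [y], the part of a level set near [y] is an interval, whose mass is an
    increment of [ids mu]. So [K.[y]] times the difference quotient of [ids mu] is close to [kappa]
    times that of [H \o D], which tends to [kappa * h * K.[y]]; the positive factor [K.[y]]
    cancels. *)
Lemma is_derive_ids : is_derive y (1:R) (ids mu) (kappa * h).
Proof.
have K0 := slope_gt0; have /andP[ly yr] := lyr.
apply: quotient_cvg_derive; apply/cvgrPdist_le => e e0.
have hK0 : 0 < h * K.[y] by rewrite mulr_gt0.
(* Half of the error [e * K.[y]] goes to [eta * Qr], where [Qr <= h * K.[y] + 1] since [c1 <= 1];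
   the other half goes to [kappa * c1]. *)
pose eta := e * K.[y] / (2 * (h * K.[y] + 1)).
have eta0 : 0 < eta by rewrite divr_gt0 ?mulr_gt0//; lra.
have [d0 d00 Hd] := level_near_bound eta0.
have [d1 d10 Hinc] := increasing_near.
pose d := Num.min d0 d1.
have d_gt0 : 0 < d by rewrite lt_min d00.
have [|e1 e10 He1] := Hd d; first by rewrite d_gt0 ge_min lexx.
have dHD : is_derive y (1:R) (H \o horner D) (h * K.[y]).
  apply: is_derive1_comp.
  rewrite -deriv_slope derivE derive1E; apply: derivableP; exact: derivable_horner.
pose c1 := Num.min 1 (e * K.[y] / (2 * kappa)).
have c10 : 0 < c1 by rewrite lt_min ltr01 divr_gt0 ?mulr_gt0//; lra.
have /cvgrPdist_le /(_ _ c10) HQ := quotient_derive_cvg dHD.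
(* Keeps [D.[t + y]] inside []l, r[] and within the range of [level_near_bound]. *)
pose e2 := Num.min e1 (Num.min ((D.[y] - l) / 2) ((r - D.[y]) / 2)).
have e20 : 0 < e2 by rewrite !lt_min; lra.
have e21 : e2 <= e1 by rewrite /e2 ge_min lexx.
have e22 : e2 <= (D.[y] - l) / 2 by rewrite /e2 !ge_min lexx orbT.
have e23 : e2 <= (r - D.[y]) / 2 by rewrite /e2 !ge_min lexx !orbT.
have /cvgrPdist_le /(_ _ e20) /nbhs_ballP [d2 /= d20 hd2] := @continuous_horner _ D y.
near=> t.
have t0 : t != 0 by near: t; exact: nbhs_dnbhs_neq.
have td : `|t| < d by near: t; apply: dnbhs0_lt.
have td2 : `|t| < d2 by near: t; apply: dnbhs0_lt.
have tQ : `|h * K.[y] - t^-1 * ((H \o horner D) (t + y) - (H \o horner D) y)| <= c1 by near: t.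
have Dt : `|D.[y] - D.[t + y]| <= e2.
  by apply: hd2; rewrite /ball /= opprD addrCA subrr addr0 normrN.
have mono u v : u \in `]y - d, y + d[ -> v \in `]y - d, y + d[ -> (D.[u] <= D.[v]) = (u <= v).
  have dd1 : d <= d1 by rewrite /d ge_min lexx orbT.
  have wide z : z \in `]y - d, y + d[ -> z \in `]y - d1, y + d1[ by rewrite !in_itv /=; lra.
  move=> /wide hu /wide hv; case: (ltgtP u v) => [uv|vu|->]; last exact: lexx.
  - by rewrite ltW// Hinc.
  - by apply/negbTE; rewrite -ltNge Hinc.
have trange : t + y \in `]y - d, y + d[ by move: td; rewrite in_itv /= ltr_norml; lra.
have yrange : y \in `]y - d, y + d[ by rewrite in_itv /=; lra.
have levelE u v : u \in `]y - d, y + d[ -> v \in `]y - d, y + d[ ->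
    level D D.[u] D.[v] `&` near_set d = [set x | x \in `[u, v]].
  move=> hu hv; apply/seteqP; split => x; rewrite /near_set /= ![_ \in `[_, _]]in_itv /=.
    by move=> [/andP[h1 h2] hx]; apply/andP; split; rewrite -mono.
  move=> /andP[ux xv].
  have hx : x \in `]y - d, y + d[ by move: hu hv; rewrite !in_itv /=; lra.
  by rewrite !mono// ux xv.
have /andP[Dt1 Dt2] : - e2 <= D.[y] - D.[t + y] <= e2 by rewrite -ler_norml.
have Dlr : l < D.[t + y] < r by lra.
set Q := t^-1 * (ids mu (t + y) - ids mu y).
set Qr := t^-1 * _ in tQ.
(* This is [level_near_bound] divided by [|t|]. For negative [t] the interval is [[t + y, y]], and
   both increments change sign together with [t]. *)
have key : `|kappa * Qr - K.[y] * Q| <= eta * Qr.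
  case: (ltgtP t 0) t0 => // [tn|tp] _.
    have le_ty : t + y <= y by lra.
    have h1 := ids_increment le_ty Dlr.
    have hD : D.[t + y] <= D.[y] by rewrite mono.
    have /(_ D.[t + y] D.[y]) := He1; rewrite levelE// -h1 hD lexx => h2.
    have {}h2 := h2 ltac:(lra) isT yr ltac:(lra) ltac:(lra).
    have tni : 0 <= - t^-1 by rewrite oppr_ge0 invr_le0 ltW.
    have := ler_wpM2l tni h2; rewrite -{1}(ger0_norm tni) -normrM => h3.
    move: h3; rewrite /Qr /Q /=.
    by congr (`|_| <= _); ring.
  have le_yt : y <= t + y by lra.
  have h1 := ids_increment le_yt lyr.
  have hD : D.[y] <= D.[t + y] by rewrite mono.
  have /(_ D.[y] D.[t + y]) := He1; rewrite levelE// -h1 hD lexx => h2.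
  have {}h2 := h2 ly isT ltac:(lra) ltac:(lra) ltac:(lra).
  have tni : 0 <= t^-1 by rewrite invr_ge0 ltW.
  have := ler_wpM2l tni h2; rewrite -{1}(ger0_norm tni) -normrM => h3.
  move: h3; rewrite /Qr /Q /=.
  by congr (`|_| <= _); ring.
have c1a : c1 <= 1 by rewrite /c1 ge_min lexx.
have c1b : kappa * c1 <= e * K.[y] / 2.
  have : c1 <= e * K.[y] / (2 * kappa) by rewrite /c1 ge_min lexx orbT.
  by rewrite -(ler_pM2l kappa_gt0) => /le_trans; apply; rewrite le_eqVlt; apply/orP; left; apply/eqP; field; rewrite gt_eqF.
have etaE : eta * (h * K.[y] + 1) = e * K.[y] / 2.
  by rewrite /eta; field; rewrite gt_eqF//; lra.
rewrite -/Q; clearbody Q Qr eta c1.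
rewrite -(ler_pM2r K0) -{1}(gtr0_norm K0) -normrM.
move: key tQ; rewrite !ler_norml => /andP[k1 k2] /andP[q1 q2].
have q3 : eta * Qr <= eta * (h * K.[y] + 1) by rewrite ler_pM2l//; lra.
have q4 : kappa * (h * K.[y] - Qr) <= kappa * c1 by rewrite ler_pM2l.
have q5 : kappa * (- c1) <= kappa * (h * K.[y] - Qr) by rewrite ler_pM2l.
by apply/andP; split; nra.
Unshelve. all: by end_near. Qed.

End LocalDensity.

(** * Derivative of the integrated density of states *)

Section DensityOfStates.
Context {R : realType}.
Variables (a b : int -> R) (p : nat) (mu : {measure set R -> \bar R}).
Hypothesis a_gt0 : forall n, 0 < a n.
Hypothesis per : jperiodic a b p.
Hypothesis p_gt0 : (0 < p)%N.
Hypothesis dos : is_dos a b p mu.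
Local Notation banded := (banded a b p).
Local Notation D := (discrX a b p).
Local Notation dosL := (dosL a b p).
Local Notation level D s t := [set x | D.[x] \in `[s, t]].

Lemma dos_finite : (mu setT < +oo)%E.
Proof.
have [_ /(_ 0)] := dos; under eq_integral do rewrite expr0.
by rewrite integral_cst// mul1e => ->; rewrite ltry.
Qed.

Lemma pint_level B (Q w : {poly R}) (s t : R) : (forall x, window B x -> 0 <= w.[x]) ->
  (forall f, exists c, arc_mean f c /\ pint mu B setT (w * (f \Po Q)) = c * pint mu B setT w) ->
  -2 < s -> s <= t -> t < 2 ->
  pint mu B (level Q s t) w = (arc_cdf t - arc_cdf s) * pint mu B setT w.
Proof.
move=> w0 arc hs st ht.
have [ht' _] : _ /\ _ := pint_cdf dos_finite w0 arc (t := t) ltac:(lra).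
have [_ hs'] : _ /\ _ := pint_cdf dos_finite w0 arc (t := s) ltac:(lra).
rewrite mulrBl -ht' -hs'; apply/eqP; rewrite eq_sym subr_eq addrC; apply/eqP.
rewrite -pint_setU.
- congr (pint _ _ _ _); apply/seteqP; split => x /=; rewrite in_itv /=; lra.
- exact: dos_finite.
- exact: measurable_lt.
- exact: measurable_horner_itv.
- by apply/disj_setPS => x [] /=; rewrite in_itv /=; lra.
Qed.

Variable B : R.
Hypothesis mu_out : mu [set x : R | B < `|x|] = 0%E.

(** Restricting the integral to the window changes the integrand only on a null set. *)
Lemma pint_moment m : pint mu B setT 'X^m = dos_moment a b p m.
Proof.
have [_ /(_ m) E] := dos.
rewrite /pint setIT /Rintegral integral_mkcond.
rewrite -[RHS]/(fine (dos_moment a b p m)%:E) -E; congr fine.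
have mX : measurable_fun setT (fun x : R => (x ^+ m)%:E).
  apply/measurable_EFinP; rewrite (_ : (fun x => _) = horner 'X^m); first exact: measurable_horner.
  by apply/funext => x; rewrite hornerXn.
apply: ae_eq_integral => //.
- apply/(measurable_restrictT _ _).1; first exact: measurable_window.
  rewrite (_ : (fun x => _) = (fun x : R => (x ^+ m)%:E)); first exact: measurable_funTS.
  by apply/funext => x; rewrite hornerXn.
exists [set x : R | B < `|x|]; split => //.
  have -> : [set x : R | B < `|x|] = ~` window B.
    by apply/seteqP; split => x /=; rewrite /window /= ltNge => /negP.
  by apply: measurableC; exact: measurable_window.
move=> x /=; rewrite /patch; case: ifPn => [_ []|].
  by move=> _; rewrite hornerXn.
by rewrite notin_setE /window /= => /negP; rewrite -ltNge.
Qed.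

Lemma pint_dosL q : pint mu B setT q = dosL q.
Proof.
rewrite -[q]coefK poly_def; elim/big_rec: _ => [|i r _ IH]; first by rewrite pint0 dosL0.
rewrite (pintD _ dos_finite)// dosLD IH pint_moment; congr (_ * _ + _).
rewrite dosL_moments size_polyXn (bigD1 ord_max)//= coefXn eqxx mul1r big1 ?addr0// => j hj.
by rewrite coefXn (_ : (j == i :> nat) = false) ?mul0r//; apply/negbTE.
Qed.

Lemma dosL1 : dosL 1 = 1.
Proof.
rewrite dosL_moments size_poly1 big_ord1 coefC mul1r /dos_moment /=.
under eq_bigr do rewrite delta_diag.
by rewrite sumr_const card_ord mulVf// pnatr_eq0 -lt0n.
Qed.

Lemma pint_arc w : banded w -> forall f, exists c, arc_mean f c /\
  pint mu B setT (w * (f \Po D)) = c * pint mu B setT w.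
Proof.
move=> bw f; have [c [hc Hc]] := dosL_comp_discr a_gt0 per p_gt0 f.
by exists c; rewrite !pint_dosL Hc.
Qed.

Lemma pint_level1 s t : -2 < s -> s <= t -> t < 2 ->
  pint mu B (level D s t) 1 = arc_cdf t - arc_cdf s.
Proof.
move=> hs st ht; have w0 x : window B x -> 0 <= (1 : {poly R}).[x] by rewrite hornerC.
have b1 : banded 1 by exact: bandedC.
by rewrite (pint_level w0 (pint_arc b1) hs st ht) pint_dosL dosL1 mulr1.
Qed.

(** [w] may change sign, so a constant [M] that makes [M + w] nonnegative on the window is added and
    subtracted again; constants are banded too. *)
Lemma pint_level_banded w s t : banded w -> -2 < s -> s <= t -> t < 2 ->
  pint mu B (level D s t) w = dosL w * (arc_cdf t - arc_cdf s).
Proof.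
move=> bw hs st ht; have [M hM] := horner_bounded B w.
have mL : measurable (level D s t) by exact: measurable_horner_itv.
have b1 : banded 1 by exact: bandedC.
have bW : banded (M *: 1 + w).
  by move=> j n h; rewrite pactDl pactZl b1// bw// mulr0 addr0.
have W0 x : window B x -> 0 <= (M *: 1 + w).[x].
  by move=> /hM; rewrite ler_norml !hornerE; lra.
have := pint_level W0 (pint_arc bW) hs st ht.
rewrite !(pintD _ dos_finite)// pint_level1// !pint_dosL dosL1; lra.
Qed.

Lemma is_derive_ids_dos y : -2 < D.[y] < 2 -> dosL (diffquot a b p y) != 0 ->
  is_derive y (1:R) (ids mu)
   (`|dosL (diffquot a b p y)| * (2 * pi * Num.sqrt (1 - (D.[y] / 2) ^+ 2))^-1).
Proof.
move=> hD k0; set K := diffquot a b p y; set kappa := dosL K in k0 *.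
have bK : banded K by exact: banded_diffquot.
have DK := diffquotE a b p y; rewrite -/K in DK.
have sq0 : 0 < 1 - (D.[y] / 2) ^+ 2 by nra.
have h0 : 0 < (2 * pi * Num.sqrt (1 - (D.[y] / 2) ^+ 2))^-1.
  by rewrite invr_gt0 !mulr_gt0 ?pi_gt0 ?sqrtr_gt0.
have [kpos|kneg|k00] := ltgtP 0 kappa; last by rewrite -k00 eqxx in k0.
  rewrite gtr0_norm//.
  apply: (@is_derive_ids _ _ _ dos_finite mu_out _ _ _ _ _ _ _ _ DK hD
    pint_level1 _ (is_derive_arc_cdf hD) h0 kpos).
  by move=> s t hs st ht; rewrite pint_level_banded.
rewrite ltr0_norm//.
(* A negative mean of [K] means that [D] decreases at [y]. The positive case is then applied to
   [- D] and [- K], with the reflected distribution function [- arc_cdf (- t)]. *)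
have NDK : (- K) * ('X - y%:P) = (- D) - (- D).[y]%:P by rewrite mulNr DK hornerN polyCN; ring.
have NhD : -2 < (- D).[y] < 2 by rewrite hornerN; lra.
have levelN s t : level (- D) s t = level D (- t) (- s).
  by apply/seteqP; split => x /=; rewrite !in_itv /= hornerN; lra.
have NK A q : measurable A -> pint mu B A (- q) = - pint mu B A q.
  by move=> mA; rewrite -[- q]addr0 -scaleN1r (pintD _ dos_finite)// pint0; ring.
have dH : is_derive (- D).[y] (1:R) (fun t => - arc_cdf (- t)) (2 * pi * Num.sqrt (1 - (D.[y] / 2) ^+ 2))^-1.
  have h : is_derive (- (- D).[y]) (1:R) arc_cdf (2 * pi * Num.sqrt (1 - (D.[y] / 2) ^+ 2))^-1.
    by rewrite hornerN opprK; exact: is_derive_arc_cdf.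
  have hN : is_derive (- D).[y] (1:R) (fun t => - t) (-1) by exact: is_deriveNid.
  have hc := @is_derive1_comp _ arc_cdf (fun t => - t) _ _ _ h hN.
  have := is_deriveN hc; rewrite mulrN1 opprK.
  exact.
have Nkappa : 0 < - kappa by rewrite oppr_gt0.
apply: (@is_derive_ids _ _ _ dos_finite mu_out _ _ _ _ _ _ _ _ NDK NhD _ _ dH h0 Nkappa) => s t hs st ht.
- by rewrite levelN pint_level1; lra.
- rewrite levelN NK; last exact: measurable_horner_itv.
  by rewrite pint_level_banded//; [rewrite -/kappa; ring|lra..].
Qed.

End DensityOfStates.

(** * Conjugation to rotations *)

Section Conjugation.
Context {R : realType}.
Variables (a b : int -> R) (p : nat) (E : R).
Hypothesis a_gt0 : forall n, 0 < a n.
Hypothesis per : jperiodic a b p.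
Local Notation B j := (tprodE a b E j p).

Let aK n : a n * (a n)^-1 = 1. Proof. by rewrite mulfV// gt_eqF. Qed.
Let per_a n : a (n + p%:Z) = a n. Proof. exact: (per n).1. Qed.
Let per_i n : (a (n + p%:Z))^-1 = (a n)^-1. Proof. by rewrite per_a. Qed.
Let per_x n : E - b (n + p%:Z) = E - b n. Proof. by rewrite (per n).2. Qed.

Lemma transferE j : transfer a b E j = tmx a (fun n => (a n)^-1) (fun n => E - b n) j%:Z.
Proof.
apply/matrixP; apply: forall_ord2; apply: forall_ord2; rewrite !mxE /=; field.
all: by rewrite gt_eqF.
Qed.

Lemma AmatE j : Amat a b E j = tprodE a b E 1 j.
Proof.
elim: j => // j IH; rewrite [LHS]/= IH transferE /tprodE tprodS.
by congr (tmx _ _ _ _ *m _); lia.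
Qed.

Lemma discrE : discr a b p E = (discrX a b p).[E].
Proof. by rewrite /discr AmatE horner_discrX; apply: tr_tprod. Qed.

(** [Amat] starts at site 1, and conjugation by its first [j - 1] factors moves the start of the
    monodromy to site [j]. *)
Lemma PhiE j : (0 < j)%N -> Phi a b p E j = B j%:Z.
Proof.
move=> j0; rewrite /Phi !AmatE.
have := @tprod_monodromyC _ a (fun n => (a n)^-1) (fun n => E - b n) p per_a per_i per_x 1 j.-1.
rewrite (_ : 1 + j.-1%:Z = j%:Z); last by lia.
rewrite -/(tprodE a b E) => <-; apply: mulmxK.
by rewrite unitmxE /tprodE det_tprod// unitr1.
Qed.

Lemma tprodE_per j k : tprodE a b E (j + p%:Z) k = tprodE a b E j k.
Proof. exact: tprod_per. Qed.

(** The lower right entry of [B (j + 1) * T_j = T_j * B j], in which the zero entry of [T_j] leaves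
    one term on each side. *)
Lemma monodromy_10 j : B (j + 1) 1 0 = - a j ^+ 2 * B j 0 1.
Proof.
have := @tprod_monodromyC _ a (fun n => (a n)^-1) (fun n => E - b n) p per_a per_i per_x j 1.
rewrite /= addr0 mulmx1 -/(tprodE a b E) => /matrixP /(_ 1 1).
rewrite !mulmx2E ![tmx _ _ _ _ _ _]mxE /= => H.
apply: (@mulIf _ (- (a j)^-1)); first by rewrite oppr_eq0 invr_eq0 gt_eqF.
transitivity (B (j + 1) 1 0 * - (a j)^-1 + B (j + 1) 1 1 * 0); first by rewrite mulr0 addr0.
by rewrite H; field; rewrite gt_eqF.
Qed.

Lemma rotation_entries (Q : 'M[R]_2) : inSO2 Q -> [/\ Q 1 1 = Q 0 0, Q 0 1 = - Q 1 0 &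
  Q 0 0 ^+ 2 + Q 1 0 ^+ 2 = 1].
Proof.
case=> /matrixP O; rewrite det_mx2E => dQ.
have := O 0 0; have := O 0 1; rewrite !mulmx2E !mxE /= mulr1n mulr0n => o01 o00.
split.
- transitivity (Q 1 1 * (Q 0 0 * Q 0 0 + Q 1 0 * Q 1 0)); first by rewrite o00 mulr1.
  transitivity (Q 0 0 * (Q 0 0 * Q 1 1 - Q 0 1 * Q 1 0) + Q 1 0 * (Q 0 0 * Q 0 1 + Q 1 0 * Q 1 1)); first by ring.
  by rewrite dQ o01; ring.
- transitivity (Q 0 1 * (Q 0 0 * Q 0 0 + Q 1 0 * Q 1 0)); first by rewrite o00 mulr1.
  transitivity (Q 0 0 * (Q 0 0 * Q 0 1 + Q 1 0 * Q 1 1) - Q 1 0 * (Q 0 0 * Q 1 1 - Q 0 1 * Q 1 0)); first by ring.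
  by rewrite dQ o01; ring.
- by rewrite -o00; ring.
Qed.

(** With [Q] the rotation, Cramer's rule solves [Q M = M Y] for the entries of [Y], using
    [det M = 1]. Here [s] is the sine of the angle and half the trace its cosine. *)
Lemma conj_rotation (M Y : 'M[R]_2) : inSL2 M -> inSO2 (M *m Y *m invmx M) ->
  let s := (M *m Y *m invmx M) 1 0 in
  [/\ Y 0 1 = - s * (M 0 1 ^+ 2 + M 1 1 ^+ 2), Y 1 0 = s * (M 0 0 ^+ 2 + M 1 0 ^+ 2) &
      s ^+ 2 = 1 - (\tr Y / 2) ^+ 2].
Proof.
move=> dM SOQ; have uM : M \in unitmx by rewrite unitmxE dM unitr1.
set Q := M *m Y *m invmx M in SOQ *; move=> s.
have QM : Q *m M = M *m Y by rewrite mulmxKV.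
have trQ : \tr Y = \tr Q by rewrite /Q -mulmxA mxtrace_mulC -mulmxA mulVmx// mulmx1.
have [q11 q01 q2] := rotation_entries SOQ.
rewrite /inSL2 det_mx2E in dM.
have e i j : Q i 0 * M 0 j + Q i 1 * M 1 j = M i 0 * Y 0 j + M i 1 * Y 1 j.
  by rewrite -!mulmx2E QM.
have := (e 0 0, e 0 1, e 1 0, e 1 1); rewrite !q11 !q01 -/s => -[[[e00 e01] e10] e11].
split.
- transitivity (Y 0 1 * (M 0 0 * M 1 1 - M 0 1 * M 1 0)); first by rewrite dM mulr1.
  transitivity (M 1 1 * (M 0 0 * Y 0 1 + M 0 1 * Y 1 1) - M 0 1 * (M 1 0 * Y 0 1 + M 1 1 * Y 1 1)); first by ring.
  by rewrite -e01 -e11; ring.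
- transitivity (Y 1 0 * (M 0 0 * M 1 1 - M 0 1 * M 1 0)); first by rewrite dM mulr1.
  transitivity (M 0 0 * (M 1 0 * Y 0 0 + M 1 1 * Y 1 0) - M 1 0 * (M 0 0 * Y 0 0 + M 0 1 * Y 1 0)); first by ring.
  by rewrite -e00 -e10; ring.
- rewrite trQ mxtrace2E q11 -/s in q2 *.
  have -> : (Q 0 0 + Q 0 0) / 2 = Q 0 0 by field.
  by lra.
Qed.

Lemma hs_norm_sq (M : 'M[R]_2) :
  hs_norm M ^+ 2 = (M 0 0 ^+ 2 + M 1 0 ^+ 2) + (M 0 1 ^+ 2 + M 1 1 ^+ 2).
Proof.
rewrite /hs_norm.
have -> : \tr (M^T *m M) = (M 0 0 ^+ 2 + M 1 0 ^+ 2) + (M 0 1 ^+ 2 + M 1 1 ^+ 2).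
  by rewrite mxtrace2E !mulmx2E !mxE; ring.
by rewrite sqr_sqrtr// !addr_ge0 ?sqr_ge0.
Qed.

Lemma sum_period (f : int -> R) : f p%:Z = f 0 ->
  \sum_(n < p) f (n : nat)%:Z = \sum_(1 <= j < p.+1) f j%:Z.
Proof.
move=> fp; rewrite big_add1 /= -(big_mkord xpredT (fun n => f n%:Z)).
case: p fp => [|q] fp; first by rewrite !big_geq.
by rewrite big_nat_recl// [RHS]big_nat_recr//= addrC fp.
Qed.

Variable M : nat -> 'M[R]_2.
Hypothesis p_gt0 : (0 < p)%N.
Hypothesis DE : -2 < discr a b p E < 2.
Hypothesis M_conj : forall j : nat, (1 <= j <= p)%N ->
  inSL2 (M j) /\ inSO2 (M j *m Phi a b p E j *m invmx (M j)).

Let col0 j := M j 0 0 ^+ 2 + M j 1 0 ^+ 2.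
Let col1 j := M j 0 1 ^+ 2 + M j 1 1 ^+ 2.

Let col_gt0 j : (1 <= j <= p)%N -> 0 < col0 j /\ 0 < col1 j.
Proof.
move=> /M_conj [+ _]; rewrite /inSL2 det_mx2E /col0 /col1 => d.
split; rewrite lt_neqAle addr_ge0 ?sqr_ge0// andbT eq_sym paddr_eq0 ?sqr_ge0// !sqrf_eq0;
  apply/negP => /andP[/eqP e1 /eqP e2]; move: d; rewrite e1 e2 ?mul0r ?mulr0 subrr;
  by move/esym/eqP; rewrite oner_eq0.
Qed.

Let discr_lt : 0 < 1 - (discr a b p E / 2) ^+ 2.
Proof. by move: DE; move: (discr a b p E) => t /andP[t1 t2]; nra. Qed.

(** All monodromies have the same trace, so their sines agree up to sign. The signs agree as well,
    because [monodromy_10] relates the sines at neighbouring sites through positive factors. *)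
Lemma rotation_angle : exists s, [/\ s != 0, s ^+ 2 = 1 - (discr a b p E / 2) ^+ 2 &
  forall j, (1 <= j <= p)%N ->
    B j%:Z 0 1 = - s * col1 j /\ B j%:Z 1 0 = s * col0 j].
Proof.
have sq0 := discr_lt.
pose sg j := (M j *m Phi a b p E j *m invmx (M j)) 1 0.
have H j : (1 <= j <= p)%N -> [/\ B j%:Z 0 1 = - sg j * col1 j, B j%:Z 1 0 = sg j * col0 j &
    sg j ^+ 2 = 1 - (discr a b p E / 2) ^+ 2].
  move=> hj; have [h1 h2] := M_conj hj; have := conj_rotation h1 h2.
  rewrite -/(sg j) PhiE; last by case/andP: hj.
  by rewrite discrE horner_discrX (_ : \tr (B j%:Z) = \tr (B 0))//; exact: tr_tprod.
have sgE j : (1 <= j <= p)%N -> sg j = sg 1%N.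
  elim: j => // -[//|j] IH hj.
  have hj' : (1 <= j.+1 <= p)%N by lia.
  rewrite -IH//; have [x1 _ x3] := H _ hj'; have [_ y2 y3] := H _ hj.
  have [c1 _] := col_gt0 hj; have [_ c2] := col_gt0 hj'.
  have e := monodromy_10 j.+1%:Z; rewrite (_ : j.+1%:Z + 1 = j.+2%:Z) in e; last by lia.
  rewrite y2 x1 in e.
  have /eqP : sg j.+2 ^+ 2 = sg j.+1 ^+ 2 by rewrite x3 y3.
  (* Opposite signs would make a sum of two positive terms vanish. *)
  rewrite eqf_sqr => /predU1P[//|/eqP E2]; exfalso.
  move: e; rewrite E2 => e.
  have s0 : sg j.+1 != 0 by rewrite -sqrf_eq0 x3 gt_eqF.
  have : sg j.+1 * (col0 j.+2 + a j.+1%:Z ^+ 2 * col1 j.+1) = 0.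
    transitivity (- (- sg j.+1 * col0 j.+2) + sg j.+1 * (a j.+1%:Z ^+ 2 * col1 j.+1)); first by ring.
    by rewrite e; ring.
  move/eqP; rewrite mulf_eq0 (negbTE s0) /= => /eqP E3.
  have : 0 < a j.+1%:Z ^+ 2 * col1 j.+1 by rewrite mulr_gt0// exprn_gt0.
  by lra.
have h1 : (1 <= 1 <= p)%N by rewrite p_gt0.
have [_ _ s2] := H _ h1.
exists (sg 1%N); split => //; first by rewrite -sqrf_eq0 s2 gt_eqF.
by move=> j hj; have [] := H j hj; rewrite sgE.
Qed.

(** After multiplication by the common sine, [monodromy_10] exchanges the first column at [j + 1]
    for [a j ^+ 2] times the second column at [j]; periodicity closes the shifted sum. *)
Lemma sum_hs_norm : \sum_(1 <= j < p.+1) hs_norm (M j) ^+ 2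
  = \sum_(1 <= j < p.+1) (1 + a j%:Z ^+ 2) * col1 j.
Proof.
have [s [s0 _ H]] := rotation_angle.
under eq_bigr do rewrite hs_norm_sq.
rewrite (eq_bigr (fun j => col0 j + col1 j))// [RHS](eq_bigr (fun j => a j%:Z ^+ 2 * col1 j + col1 j)); last by move=> j _; ring.
rewrite big_split [RHS]big_split /=; congr (_ + _); apply: (mulfI s0); rewrite !mulr_sumr.
transitivity (\sum_(1 <= j < p.+1) B j%:Z 1 0).
  by apply: eq_big_nat => j hj; have [_ ->] := H j hj.
transitivity (\sum_(n < p) - a (n : nat)%:Z ^+ 2 * B (n : nat)%:Z 0 1).
  rewrite big_add1 /= big_mkord; apply: eq_bigr => n _.
  by rewrite -monodromy_10; congr (tprodE _ _ _ _ _ _ _); lia.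
rewrite (sum_period (f := fun n => - a n ^+ 2 * B n 0 1)).
  by apply: eq_big_nat => j hj; have [-> _] := H j hj; ring.
by have := per_a 0; have := tprodE_per 0 p; rewrite !add0r => -> ->.
Qed.

Lemma dosL_diffquot_norm : `|dosL a b p (diffquot a b p E)|
  = p%:R^-1 * Num.sqrt (1 - (discr a b p E / 2) ^+ 2) * \sum_(1 <= j < p.+1) col1 j.
Proof.
have [s [s0 s2 H]] := rotation_angle.
rewrite dosL_diffquot// (sum_period (f := fun n => B n 0 1)); last first.
  by have := tprodE_per 0 p; rewrite !add0r => ->.
rewrite (_ : \sum_(1 <= j < p.+1) _ = - s * \sum_(1 <= j < p.+1) col1 j).
  rewrite mulrA mulrNN normrM normrM -s2 sqrtr_sqr (ger0_norm (_ : 0 <= \sum_(1 <= j < p.+1) col1 j)).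
    by rewrite ger0_norm// invr_ge0 ler0n.
  by rewrite big_nat; apply: sumr_ge0 => j /col_gt0 [_ /ltW].
by rewrite mulr_sumr; apply: eq_big_nat => j hj; have [-> _] := H j hj.
Qed.

Lemma sum_col1_gt0 : 0 < \sum_(1 <= j < p.+1) col1 j.
Proof.
rewrite big_nat_recr//=; apply: ltr_wpDl.
  by rewrite big_nat; apply: sumr_ge0 => j hj; apply: ltW; apply: (@col_gt0 j _).2; lia.
by apply: (@col_gt0 p _).2; rewrite p_gt0 leqnn.
Qed.

Lemma ler_supnorm j : (1 <= j <= p)%N -> a j%:Z <= supnorm a p.
Proof.
move=> hj.
(* [supnorm] ranges over [0, ..., p - 1], so the index [p] is wrapped to 0. *)
have [k kp ->] : exists2 k, (k < p)%N & a j%:Z = a k%:Z.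
  case: (ltnP j p) => h; first by exists j.
  by exists 0%N => //; rewrite -(per_a 0) add0r; congr a; lia.
apply: (@le_trans _ _ `|a k%:Z|); first exact: ler_norm.
exact: (le_bigmax _ (fun n : 'I_p => `|a (n : nat)%:Z|) (Ordinal kp)).
Qed.

Lemma sum_hs_norm_le : \sum_(1 <= j < p.+1) hs_norm (M j) ^+ 2
  <= (1 + supnorm a p ^+ 2) * \sum_(1 <= j < p.+1) col1 j.
Proof.
rewrite sum_hs_norm mulr_sumr; apply: ler_sum_nat => j hj.
have [_ c] := col_gt0 hj.
rewrite ler_pM2r// lerD2l lerXn2r ?nnegrE//.
- exact: ltW.
- by apply: le_trans (ler_supnorm hj); exact: ltW.
- exact: ler_supnorm.
Qed.

(** The sine in the mean of [K] cancels the square root in the arcsine density at [D(E)]. *)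
Lemma is_derive_ids_hs (mu : {measure set R -> \bar R}) : is_dos a b p mu ->
  is_derive E (1:R) (ids mu) ((2 * pi)^-1 / p%:R * \sum_(1 <= j < p.+1) col1 j).
Proof.
move=> dos; have [[B0 mu_out] _] := dos.
have sq0 := discr_lt.
have p0 : 0 < p%:R :> R by rewrite ltr0n.
have k0 : dosL a b p (diffquot a b p E) != 0.
  rewrite -normr_gt0 dosL_diffquot_norm !mulr_gt0 ?invr_gt0 ?sqrtr_gt0//.
  exact: sum_col1_gt0.
have hD : -2 < (discrX a b p).[E] < 2 by rewrite -discrE.
have := is_derive_ids_dos a_gt0 per p_gt0 dos mu_out hD k0.
rewrite dosL_diffquot_norm -discrE.
set X := Num.sqrt _; have X0 : X != 0 by rewrite gt_eqF// sqrtr_gt0.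
set S := \sum_(1 <= j < p.+1) _.
rewrite (_ : p%:R^-1 * X * S * (2 * pi * X)^-1 = (2 * pi)^-1 / p%:R * S)//.
have piR : pi != 0 :> R by rewrite gt_eqF// pi_gt0.
by move: (pi : R) piR => c c0; field; rewrite X0 c0 gt_eqF.
Qed.

End Conjugation.

Theorem theoremA1 (R : realType) :
  exists C : R -> R, (forall A : R, 0 < C A) /\
  forall (p : nat) (a b : int -> R) (mu : {measure set R -> \bar R}),
    (0 < p)%N -> (forall n, 0 < a n) -> jperiodic a b p -> is_dos a b p mu ->
    forall E : R, -2 < discr a b p E < 2 ->
    forall M : nat -> 'M[R]_2,
      (forall j : nat, (1 <= j <= p)%N ->
         inSL2 (M j) /\ inSO2 (M j *m Phi a b p E j *m invmx (M j))) ->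
      derivable (ids mu) E 1 /\
      C (supnorm a p) / p%:R * (\sum_(1 <= j < p.+1) hs_norm (M j) ^+ 2)
        <= derive1 (ids mu) E /\
      ((forall n, a n = a 0) ->
         derive1 (ids mu) E =
           (2 * (1 + a 0 ^+ 2) * pi)^-1 / p%:R
             * (\sum_(1 <= j < p.+1) hs_norm (M j) ^+ 2)).
Proof.
(* The derivative is [1 / (2 pi p)] times the sum of the squared second columns, and
   [sum_hs_norm_le] compares that sum with the norms at the cost of [1 + A ^+ 2]. For constant [a]
   this comparison is an equality. *)
exists (fun A => (2 * pi * (1 + A ^+ 2))^-1); split.
  by move=> A; rewrite invr_gt0 !mulr_gt0 ?pi_gt0// ltr_wpDr ?sqr_ge0.
move=> p a b mu p_gt0 a_gt0 per dos E DE M M_conj.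
have dE := is_derive_ids_hs a_gt0 per p_gt0 DE M_conj dos.
have piR : pi != 0 :> R by rewrite gt_eqF// pi_gt0.
have pR : p%:R != 0 :> R by rewrite pnatr_eq0 -lt0n.
split; first exact: (@ex_derive _ _ _ _ _ _ _ dE).
rewrite derive1E (@derive_val _ _ _ _ _ _ _ dE); split.
  have A0 : 0 < 1 + supnorm a p ^+ 2 by rewrite ltr_wpDr ?sqr_ge0.
  have := sum_hs_norm_le a_gt0 per p_gt0 DE M_conj.
  set S := \sum_(1 <= j < p.+1) (_ + _); set T := \sum_(1 <= j < p.+1) _ => ST.
  rewrite (_ : _ * S = (2 * pi * (1 + supnorm a p ^+ 2))^-1 / p%:R * ((1 + supnorm a p ^+ 2) * S)).
    by rewrite ler_wpM2l// mulr_ge0 ?invr_ge0 ?ler0n// !mulr_ge0 ?pi_ge0// ltW.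
  by move: (pi : R) piR => c c0; field; rewrite c0 pR gt_eqF.
move=> a_const; rewrite (sum_hs_norm a_gt0 per p_gt0 DE M_conj).
under [in RHS]eq_bigr do rewrite a_const.
have A0 : 0 < 1 + a 0 ^+ 2 by rewrite ltr_wpDr ?sqr_ge0.
rewrite -mulr_sumr; set S := \sum_(1 <= j < p.+1) _.
by move: (pi : R) piR => c c0; field; rewrite c0 pR gt_eqF.
Qed.
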